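(* Let $w$ be any element of the Weyl group of a symmetrizable Kac-Moody algebra, with a fixed reduced word, and $t_0$ the associated quantum seed, with $t_0[1]=\overleftarrow\mu t_0$ (see context). The automorphism $\mathrm{tw}_w$ (extended to $\mathcal F(t_0)$) decomposes as $\mathrm{tw}_w=\overleftarrow\mu^*\,\mathrm{var}_w$ such that $\mathrm{var}_w:\mathcal F(t_0)\cong\mathcal F(t_0[1])$ is a variation map. In particular, $\mathrm{tw}_w$ is a twist automorphism of Donaldson-Thomas type.
   Context: **Quantum seeds.** $\Bbbk=\mathbb Z[q^{\pm1/2}]$, $v=q^{1/2}$, $[x]_+=\max(x,0)$. $I=I_{uf}\sqcup I_f$ is a finite set. A quantum seed $t$ consists of an integer matrix $\tilde B(t)=(b_{ij})_{i\in I,j\in I_{uf}}$ of full rank $|I_{uf}|$ with skew-symmetrizable part $(b_{ij})_{i,j\in I_{uf}}$, a skew-symmetric integer matrix $\Lambda(t)=(\Lambda_{ij})_{i,j\in I}$ with $\tilde B(t)^T\Lambda(t)=(D'\ 0)$, $D'=\mathrm{diag}(d'_k)_{k\in I_{uf}}$, $d'_k\in\mathbb Z_{>0}$, and variables $X_i(t)$. $M^\circ(t)=\bigoplus_{i\in I}\mathbb Zf_i\cong\mathbb Z^I$ carries $\lambda(f_i,f_j)=\Lambda_{ij}$. $\mathcal{LP}(t)=\bigoplus_m\Bbbk X(t)^m$ has commutative product $X^m\cdot X^{m'}=X^{m+m'}$ and twisted product $X^m*X^{m'}=v^{\lambda(m,m')}X^{m+m'}$; $X_i(t)=X(t)^{f_i}$;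 as an algebra it is taken with $*$; $\mathcal F(t)$ is its skew-field of fractions. $Y_k(t)=X(t)^{\sum_ib_{ik}f_i}$. $\mathcal P=\{X(t)^u:u\in\mathbb Z^{I_f}\}$ (frozen variables are the same in all seeds). For $k\in I_{uf}$, $t'=\mu_kt$ has $b'_{ij}=-b_{ij}$ if $k\in\{i,j\}$, otherwise $b'_{ij}=b_{ij}+b_{ik}[b_{kj}]_++[-b_{ik}]_+b_{kj}$; $\Lambda(t')_{ij}=\lambda(f'_i,f'_j)$ with $f'_i=f_i$ ($i\ne k$), $f'_k=-f_k+\sum_j[-b_{jk}]_+f_j$; $\mu_k^*:\mathcal F(t')\cong\mathcal F(t)$ sends $X_i(t')\mapsto X_i(t)$ ($i\ne k$), $X_k(t')\mapsto X(t)^{-f_k+\sum_j[-b_{jk}]_+f_j}+X(t)^{-f_k+\sum_j[b_{jk}]_+f_j}$. A mutation sequence $\overleftarrow\mu$ with $t_2=\overleftarrow\mu t_1$ induces the composite $\overleftarrow\mu^*:\mathcal F(t_2)\cong\mathcal F(t_1)$. $\mathcal A_q(t)\subset\mathcal{LP}(t)$ is the $\Bbbk$-algebra generated by all quantum cluster variables (pulled back to $\mathcal F(t)$ from all seeds mutation-equivalent to $t$) and the inverses of the frozen ones. An element of the form $X(t)^g\cdot(1+\sum_{0\ne n\in\mathbb N^{I_{uf}}}c_nX(t)^{\tilde B(t)n})$ is pointed, of degree $g$; cluster variables are pointed. **Twist automorphisms.** $t$ is injective-reachable if there are $t[1]=\overleftarrow\mu t$ and a permutation $\sigma$ of $I_{uf}$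 such that for each $k\in I_{uf}$ the $I_{uf}$-part of the degree of $I_k(t):=\overleftarrow\mu^*X_{\sigma k}(t[1])\in\mathcal{LP}(t)$ is $-f_k$. Then $b_{\sigma i,\sigma j}(t[1])=b_{ij}(t)$ ($i,j\in I_{uf}$) and $d'_{\sigma k}=d'_k$. A variation map $\mathcal F(t)\cong\mathcal F(t[1])$ is an algebra isomorphism $\mathrm{var}$ (for $*$) with $\mathrm{var}(X_k(t))=p_k\cdot X_{\sigma k}(t[1])$ for some $p_k\in\mathcal P$, $\mathrm{var}(Y_k(t))=Y_{\sigma k}(t[1])$ for $k\in I_{uf}$, and $\mathrm{var}(\mathcal P)=\mathcal P$. A twist automorphism of Donaldson-Thomas type on $\mathcal F(t)$ is a composite $\overleftarrow\mu^*\mathrm{var}$ with $\mathrm{var}$ such a variation map. **Quantum groups.** A root datum for $\mathfrak g$: index set $[1,r]$, weight lattice $P$ with dual $P^\vee$, linearly independent simple roots $\alpha_i\in P$ and simple coroots $\alpha_i^\vee\in P^\vee$, a symmetric $\mathbb Q$-valued bilinear form $(\,,)$ on $P$ with $\mathrm d_i=\frac12(\alpha_i,\alpha_i)\in\mathbb Z_{>0}$, $\langle\alpha_i^\vee,\mu\rangle=2(\alpha_i,\mu)/(\alpha_i,\alpha_i)$, $C_{ij}=\langle\alpha_i^\vee,\alpha_j\rangle$ the generalized Cartan matrix; fundamental weights $\varpi_i\in P$, $\langle\alpha_i^\vee,\varpi_j\rangle=\delta_{ij}$, are assumed to exist, $\rho=\sum_i\varpi_i$; $\mathrm{Tr}(\sum\mu_i\alpha_i)=\sum\mu_i$;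 $W$ is the Weyl group with simple reflections $s_i$. $U_q$ is the quantized enveloping $\mathbb Q(q)$-algebra with generators $E_i,F_i,K^h$ ($h\in P^\vee$) and the usual relations ($K^hE_iK^{-h}=q^{\langle h,\alpha_i\rangle}E_i$, $K^hF_iK^{-h}=q^{-\langle h,\alpha_i\rangle}F_i$, $E_iF_j-F_jE_i=\delta_{ij}\frac{K_i-K_i^{-1}}{q_i-q_i^{-1}}$, $q$-Serre relations), $q_i=q^{\mathrm d_i}$, $K_i=K^{\mathrm d_i\alpha_i^\vee}$; $E_i^{(n)},F_i^{(n)}$ are divided powers with respect to $q_i$. $U_q^-=\langle F_i\rangle$ is graded by $\mathrm{wt}F_i=-\alpha_i$. $T_i^{-1}$ is the automorphism of $U_q$ with $K^h\mapsto K^{s_ih}$, $E_i\mapsto-K_i^{-1}F_i$, $F_i\mapsto-E_iK_i$ and, for $j\ne i$, $E_j\mapsto\sum_{a+b=-C_{ij}}(-1)^aq_i^{-a}E_i^{(a)}E_jE_i^{(b)}$, $F_j\mapsto\sum_{a+b=-C_{ij}}(-1)^aq_i^aF_i^{(b)}F_jF_i^{(a)}$. Let $(i_1,\dots,i_l)$ be the reduced word of $w$, $\beta_k=s_{i_1}\cdots s_{i_{k-1}}\alpha_{i_k}$. For $\mathbf c\in\mathbb N^l$ put $F_{-1}(m\beta_k)=T_{i_1}^{-1}\cdots T_{i_{k-1}}^{-1}(F_{i_k}^{(m)})$, $F_{-1}(\mathbf c)=F_{-1}(c_l\beta_l)\cdots F_{-1}(c_1\beta_1)$. $\mathrm A_q[N_-(w)]$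 is the subalgebra of $U_q^-$ with $\mathbb Q(q)$-basis $\{F_{-1}(\mathbf c)\}$. Dual PBW basis: $F^{up}_{-1}(\mathbf c)=F_{-1}(\mathbf c)\prod_k\prod_{s=1}^{c_k}(1-q_{i_k}^{2s})$. Dual bar involution: $\sigma(x)=(-1)^{\mathrm{Tr}(\mathrm{wt}x)}q^{\frac12(\mathrm{wt}x,\mathrm{wt}x)-(\mathrm{wt}x,\rho)}\psi(x)$ for homogeneous $x$, $\psi$ the $\mathbb Q$-linear ring anti-automorphism of $U_q^-$ with $q\mapsto q^{-1}$, $F_i\mapsto F_i$. Write $\mathbf c'\prec\mathbf c$ if $\mathbf c'$ is smaller than $\mathbf c$ both lexicographically (first differing entry) and reverse lexicographically (last differing entry). The dual canonical basis $B^{up}_{-1}=\{B^{up}_{-1}(\mathbf c)\}$ is the unique $\sigma$-invariant basis with $B^{up}_{-1}(\mathbf c)-F^{up}_{-1}(\mathbf c)\in\sum_{\mathbf c'\prec\mathbf c}q\mathbb Z[q]F^{up}_{-1}(\mathbf c')$. For $j\le k$ with $i_j=i_k$, $\mathbf c_{[j,k]}$ has entry $1$ at $s\in[j,k]$ with $i_s=i_j$ and $0$ elsewhere; $D[j,k]=B^{up}_{-1}(\mathbf c_{[j,k]})$, $\beta_{[j,k]}=\sum_{s\in[j,k],i_s=i_j}\beta_s$. $\mathrm{cor}(x)=q^{-\frac14(\mathrm{wt}x,\mathrm{wt}x)+\frac12(\mathrm{wt}x,\rho)}x$ for homogeneous $x$. For $k\in[1,l]$: $k[1]=s(k)=\min\{j>k:i_j=i_k\}$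 or $+\infty$, $p(k)=\max\{j<k:i_j=i_k\}$ or $-\infty$; $k^{\min},k^{\max}$ are the smallest and largest $j$ with $i_j=i_k$. The quantum unipotent cell $\mathrm A_q[N_-^w]$ is identified (De Concini–Procesi isomorphism) with the localization of $\mathrm A_q[N_-(w)]$ at all $D[k^{\min},k^{\max}]$; its integral form $\mathrm A_q[N_-^w]_{\mathbb Z[q^{\pm1/2}]}$ is the $\mathbb Z[q^{\pm1/2}]$-algebra generated by the $F_{-1}^{up}(\beta_k)$ (dual PBW elements of unit vectors) and the inverses of the $D[k^{\min},k^{\max}]$. **The seed $t_0$.** $I=[1,l]$, $I_{uf}=\{k:s(k)\neq+\infty\}$. $\tilde B(t_0)$: $b_{jk}=1$ if $j=p(k)$; $-1$ if $j=s(k)$; $C_{i_ji_k}$ if $j<k<s(j)<s(k)$; $-C_{i_ji_k}$ if $k<j<s(k)<s(j)$; $0$ otherwise. $\Lambda(t_0)_{jk}=N(\mathbf c_{[j^{\min},j]},\mathbf c_{[k^{\min},k]})$, $N(\mathbf c,\mathbf c')=\sum_{a>b}(\beta_a,\beta_b)c_ac'_b-\sum_{a<b}(\beta_a,\beta_b)c_ac'_b$. There is an isomorphism $\mathcal A_q(t_0)\cong\mathrm A_q[N_-^w]_{\mathbb Z[q^{\pm1/2}]}$ with $X_j(t_0)\mapsto\mathrm{cor}\,D[j^{\min},j]$. The seed $t_0$ is injective-reachable; $t_0[1]=\overleftarrow\mu t_0$ has quantum cluster variables corresponding to $\mathrm{cor}\,D[j,j^{\max}]$, $j\in I$, and $I_k(t_0)=\overleftarrow\mu^*X_{\sigma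 k}(t_0[1])$ corresponds to $\mathrm{cor}\,D[k[1],k^{\max}]$ for $k\in I_{uf}$. **The automorphism $\mathrm{tw}_w$.** The (Kimura–Oya) twist automorphism $\eta_{w,q}$ is the algebra automorphism of $\mathrm A_q[N_-^w]$ with $\eta_{w,q}(D[k^{\min},k])=q^{-(\varpi_{i_k},-\beta_{[k^{\min},k]})}D[k^{\min},k^{\max}]^{-1}D[k[1],k^{\max}]$ for $k\in I_{uf}$ and $\eta_{w,q}(D[k^{\min},k^{\max}]^{-1})=q^{(\varpi_{i_k},-\beta_{[k^{\min},k^{\max}]})}D[k^{\min},k^{\max}]$. Set $\mathrm{tw}_w(x)=\eta_{w,q}(q^{-(\mathrm{wt}x,\rho)}x)$ for homogeneous $x$, and transport it to $\mathcal A_q(t_0)$ and $\mathcal F(t_0)$ by the isomorphism $\mathcal A_q(t_0)\cong\mathrm A_q[N_-^w]_{\mathbb Z[q^{\pm1/2}]}$ sending $X_j(t_0)\mapsto\mathrm{cor}\,D[j^{\min},j]$ for $j\in I$. *)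

(* Defs.v *)
From HB Require Import structures.
From mathcomp Require Import all_boot all_order perm all_algebra.
Set Implicit Arguments.
Unset Strict Implicit.
Unset Printing Implicit Defensive.
Import Order.TTheory GRing.Theory Num.Theory.
Local Open Scope ring_scope.

(** Everything lives over [Qv = Q(v)] with [v = q^(1/2)] an indeterminate.  The
    ring [Z[q^(+-1/2)]] is the subset [Zv] of [Qv]. *)

Notation Qv := {fraction {poly rat}}.

Definition v : Qv := tofrac 'X.
Definition q : Qv := v ^+ 2.

(** [qpow x = q ^ x]; only meaningful, and only used, for [x] in [(1/2) Z]. *)
Definition qpow (x : rat) : Qv := v ^ Num.floor (2%:R * x).

Definition Zv (c : Qv) : Prop :=
  exists (p : {poly int}) (n : nat), c = tofrac (map_poly intr p) / v ^+ n.

(** The ideal [q Z[q]] of [Z[q]]. *)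
Definition qZq (c : Qv) : Prop :=
  exists p : {poly int}, c = q * tofrac (map_poly intr p \Po 'X^2).

Definition anyQv (_ : Qv) : Prop := True.

Definition lincomb (R : Qv -> Prop) (V : lmodType Qv) (J : eqType)
    (P : J -> Prop) (f : J -> V) (x : V) : Prop :=
  exists (s : seq J) (c : J -> Qv),
    (forall j, j \in s -> P j /\ R (c j)) /\ x = \sum_(j <- s) c j *: f j.

Definition lin_indep (V : lmodType Qv) (J : eqType) (f : J -> V) : Prop :=
  forall (s : seq J) (c : J -> Qv), uniq s ->
    \sum_(j <- s) c j *: f j = 0 -> forall j, j \in s -> c j = 0.

Definition is_basis (V : lmodType Qv) (J : eqType) (f : J -> V)
    (A : V -> Prop) : Prop :=
  lin_indep f /\ forall x, A x <-> lincomb anyQv (fun _ => True) f x.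

Inductive gen_subalg (R : Qv -> Prop) (A : algType Qv) (S : A -> Prop) :
    A -> Prop :=
| gen_mem x of S x : gen_subalg R S x
| gen_scal c of R c : gen_subalg R S (c *: 1)
| gen_add x y of gen_subalg R S x & gen_subalg R S y : gen_subalg R S (x + y)
| gen_mul x y of gen_subalg R S x & gen_subalg R S y : gen_subalg R S (x * y).

Definition alg_iso (A B : algType Qv) (f : A -> B) : Prop :=
  [/\ linear f, monoid_morphism f & bijective f].

Definition alg_morph_on (R : Qv -> Prop) (A B : algType Qv) (SA : A -> Prop)
    (f : A -> B) : Prop :=
  [/\ f 1 = 1,
      forall x y, SA x -> SA y -> f (x + y) = f x + f y,
      forall x y, SA x -> SA y -> f (x * y) = f x * f y
    & forall c x, R c -> SA x -> f (c *: x) = c *: f x].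

Definition alg_iso_on (R : Qv -> Prop) (A B : algType Qv) (SA : A -> Prop)
    (SB : B -> Prop) (f : A -> B) : Prop :=
  [/\ alg_morph_on R SA f,
      forall x, SA x -> SB (f x),
      forall x y, SA x -> SA y -> f x = f y -> x = y
    & forall y, SB y -> exists2 x, SA x & f x = y].

Section Seeds.

Variables (I : finType) (uf : {set I}).

Definition unfrozen := {k : I | k \in uf}.

Record seed := Seed { bmat : I -> unfrozen -> int; Lam : I -> I -> int }.

Notation expo := {ffun I -> int}.

Definition fvec (i : I) : expo := [ffun j => (j == i)%:Z].

Definition lam (t : seed) (m m' : expo) : int :=
  \sum_i \sum_j m i * Lam t i j * m' j.

Definition is_quantum_seed (t : seed) : Prop :=
  [/\ exists d : unfrozen -> nat, (forall i, (0 < d i)%N) /\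
        forall i j, (d i)%:Z * bmat t (val i) j = - ((d j)%:Z * bmat t (val j) i),
      \rank (\matrix_(i < #|I|, k < #|{: unfrozen}|)
               (bmat t (enum_val i) (enum_val k))%:~R : 'M[rat]_(_, _))
        = #|{: unfrozen}|,
      forall i j, Lam t i j = - Lam t j i
    & exists d' : unfrozen -> nat, (forall k, (0 < d' k)%N) /\
        forall k j, \sum_i bmat t i k * Lam t i j
                    = if j == val k then (d' k)%:Z else 0].

(** The diagonal entries [d'_k] of [B^T Lambda = (D' 0)]. *)
Definition dprime (t : seed) (k : unfrozen) : int :=
  \sum_i bmat t i k * Lam t i (val k).

Definition pospart (x : int) : int := Num.max x 0.

(** [- f_k + sum_j [eps b_jk]_+ f_j], for the sign [eps]. *)
Definition fmut (eps : int) (t : seed) (k : unfrozen) : expo :=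
  - fvec (val k) + \sum_j fvec j *~ pospart (eps * bmat t j k).

Definition mutate (t : seed) (k : unfrozen) : seed :=
  let f' i := if i == val k then fmut (- 1) t k else fvec i in
  {| bmat := fun i j =>
       if (i == val k) || (j == k) then - bmat t i j
       else bmat t i j + bmat t i k * pospart (bmat t (val k) j)
            + pospart (- bmat t i k) * bmat t (val k) j;
     Lam := fun i j => lam t (f' i) (f' j) |}.

(** The sequence [ks] is applied from left to right. *)
Fixpoint mutseq (t : seed) (ks : seq unfrozen) : seed :=
  if ks is k :: ks' then mutseq (mutate t k) ks' else t.

(** A skew-field of fractions [F(t)] of the quantum torus [LP(t)].  The torus is
    the [Zv]-span of the basis [X^m], with the twisted product; being a
    skew-field containing [Zv] in its centre, [F(t)] is a [Qv]-algebra. *)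
Record torus_skewfield (t : seed) := TorusSkewfield {
  skf :> unitAlgType Qv;
  X : expo -> skf;
  skf_division : forall x : skf, x != 0 -> x \is a GRing.unit;
  X_mul : forall m m', X m * X m' = v ^ lam t m m' *: X (m + m');
  X_indep : lin_indep X;
  skf_fractions : forall z : skf, exists a b : skf,
    [/\ lincomb Zv (fun _ => True) X a, lincomb Zv (fun _ => True) X b,
        b != 0 & z = a / b]
}.

Variable F : forall t : seed, torus_skewfield t.

Definition clvar (t : seed) (i : I) : F t := X (F t) (fvec i).

Definition yexp (t : seed) (n : {ffun unfrozen -> nat}) : expo :=
  \sum_k \sum_i fvec i *~ (bmat t i k * (n k)%:Z).

Definition Y (t : seed) (k : unfrozen) : F t :=
  X (F t) (\sum_i fvec i *~ bmat t i k).

Definition frozen_expo (u : expo) : Prop := forall i, i \in uf -> u i = 0.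

Definition frozen_monomial (t : seed) (z : F t) : Prop :=
  exists2 u, frozen_expo u & z = X (F t) u.

Definition is_mutation_iso (t : seed) (k : unfrozen)
    (phi : F (mutate t k) -> F t) : Prop :=
  [/\ alg_iso phi,
      forall i, i != val k -> phi (clvar (mutate t k) i) = clvar t i
    & phi (clvar (mutate t k) (val k))
        = X (F t) (fmut (- 1) t k) + X (F t) (fmut 1 t k)].

(** [phi] is the composite isomorphism attached to the mutation sequence [ks]. *)
Fixpoint is_mutseq_iso (t : seed) (ks : seq unfrozen) :
    (F (mutseq t ks) -> F t) -> Prop :=
  match ks return (F (mutseq t ks) -> F t) -> Prop with
  | [::] => fun phi => phi =1 id
  | k :: ks' => fun phi =>
      exists (phi1 : F (mutate t k) -> F t)
             (phi2 : F (mutseq (mutate t k) ks') -> F (mutate t k)),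
        [/\ is_mutation_iso phi1, is_mutseq_iso phi2 & phi =1 phi1 \o phi2]
  end.

Definition cluster_algebra (t : seed) : F t -> Prop :=
  gen_subalg Zv (fun x : F t =>
    (exists ks (phi : F (mutseq t ks) -> F t) i,
        is_mutseq_iso phi /\ x = phi (clvar (mutseq t ks) i))
    \/ (exists2 j, j \notin uf & x = (clvar t j)^-1)).

Definition pointed (t : seed) (z : F t) (g : expo) : Prop :=
  exists2 y, lincomb Zv (fun n => n != [ffun=> 0%N])
                     (fun n => X (F t) (g + yexp t n)) y
           & z = X (F t) g + y.

(** [mutseq t ks], with the permutation [sg], is a seed [t[1]]. *)
Definition is_shift (t : seed) (ks : seq unfrozen) (sg : {perm unfrozen})
    (mu : F (mutseq t ks) -> F t) : Prop :=
  is_mutseq_iso mu /\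
  forall k, exists2 g, pointed (mu (clvar (mutseq t ks) (val (sg k)))) g
                     & forall i, i \in uf -> g i = - fvec (val k) i.

(** In the second clause [p_k = X^u], and its product with [X_(sg k)] is the
    commutative one of the torus. *)
Definition is_variation (t t1 : seed) (sg : {perm unfrozen})
    (var : F t -> F t1) : Prop :=
  [/\ alg_iso var,
      forall k, exists2 u, frozen_expo u &
        var (clvar t (val k)) = X (F t1) (u + fvec (val (sg k))),
      forall k, var (Y t k) = Y t1 (sg k),
      forall z, frozen_monomial z -> frozen_monomial (var z)
    & forall z', frozen_monomial z' -> exists2 z, frozen_monomial z & var z = z'].

Definition is_DT_twist (t : seed) (tw : F t -> F t) : Prop :=
  exists ks sg (mu : F (mutseq t ks) -> F t) (var : F t -> F (mutseq t ks)),
    [/\ is_shift sg mu, is_variation sg var & tw =1 mu \o var].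

End Seeds.

Section RootDatum.

Variable r : nat.

(** The weight lattice is [Z^n] in some basis, and its dual is [Z^n] in the dual
    basis. *)
Definition pairing (n : nat) (h mu : 'rV[int]_n) : int :=
  \sum_a h 0 a * mu 0 a.

Record root_datum := RootDatum {
  rkP : nat;
  form : 'rV[int]_rkP -> 'rV[int]_rkP -> rat;
  alpha : 'I_r -> 'rV[int]_rkP;
  coalpha : 'I_r -> 'rV[int]_rkP;
  varpi : 'I_r -> 'rV[int]_rkP;
  dd : 'I_r -> nat;
  formDl : forall x y z, form (x + y) z = form x z + form y z;
  formC : forall x y, form x y = form y x;
  alpha_indep : forall c : 'I_r -> int,
    \sum_i c i *: alpha i = 0 -> forall i, c i = 0;
  coalpha_indep : forall c : 'I_r -> int,
    \sum_i c i *: coalpha i = 0 -> forall i, c i = 0;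
  dd_gt0 : forall i, (0 < dd i)%N;
  form_alpha : forall i, form (alpha i) (alpha i) = 2%:R * (dd i)%:R;
  coalphaE : forall i mu, (pairing (coalpha i) mu)%:~R
    = 2%:R * form (alpha i) mu / form (alpha i) (alpha i);
  cartan_le0 : forall i j, i != j -> pairing (coalpha i) (alpha j) <= 0;
  varpiE : forall i j, pairing (coalpha i) (varpi j) = (i == j)%:Z
}.

Variable rd : root_datum.
Notation P := 'rV[int]_(rkP rd).

Definition cartan (i j : 'I_r) : int := pairing (coalpha rd i) (alpha rd j).
Definition rho : P := \sum_i varpi rd i.
Definition sref (i : 'I_r) (mu : P) : P :=
  mu - pairing (coalpha rd i) mu *: alpha rd i.
Definition cosref (i : 'I_r) (h : P) : P :=
  h - pairing h (alpha rd i) *: coalpha rd i.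

Definition wact (s : seq 'I_r) (mu : P) : P := foldr sref mu s.

Definition reduced_word (w : P -> P) (s : seq 'I_r) : Prop :=
  wact s =1 w /\ forall s', wact s' =1 w -> (size s <= size s')%N.

Definition qi (i : 'I_r) : Qv := q ^+ dd rd i.

Definition qint (i : 'I_r) (m : nat) : Qv :=
  (qi i ^+ m - qi i ^- m) / (qi i - (qi i)^-1).

Definition divpow (A : algType Qv) (i : 'I_r) (m : nat) (x : A) : A :=
  (\prod_(1 <= s < m.+1) qint i s)^-1 *: x ^+ m.

Definition Uq_relations (A : algType Qv) (E Fg : 'I_r -> A) (Kg : P -> A) :
    Prop :=
  [/\ Kg 0 = 1 /\ (forall h h', Kg (h + h') = Kg h * Kg h'),
      forall h i, Kg h * E i * Kg (- h) = q ^ pairing h (alpha rd i) *: E i,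
      forall h i, Kg h * Fg i * Kg (- h)
                  = q ^ (- pairing h (alpha rd i)) *: Fg i,
      forall i j, E i * Fg j - Fg j * E i
        = if i == j then
            (qi i - (qi i)^-1)^-1 *:
              (Kg ((dd rd i)%:Z *: coalpha rd i)
               - Kg (- ((dd rd i)%:Z *: coalpha rd i)))
          else 0
    & forall i j, i != j ->
        let m := `|1 - cartan i j|%N in
        \sum_(a < m.+1) (-1) ^+ a *:
          (divpow i a (E i) * E j * divpow i (m - a) (E i)) = 0 /\
        \sum_(a < m.+1) (-1) ^+ a *:
          (divpow i a (Fg i) * Fg j * divpow i (m - a) (Fg i)) = 0].

Record quantized_enveloping := QuantizedEnveloping {
  Uq :> algType Qv;
  Eg : 'I_r -> Uq;
  Fg : 'I_r -> Uq;
  Kg : P -> Uq;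
  Uq_rel : Uq_relations Eg Fg Kg;
  Uq_ex : forall (A : algType Qv) (E' F' : 'I_r -> A) (K' : P -> A),
    Uq_relations E' F' K' ->
    exists f : {lrmorphism Uq -> A},
      [/\ forall i, f (Eg i) = E' i, forall i, f (Fg i) = F' i
        & forall h, f (Kg h) = K' h];
  Uq_uniq : forall (A : algType Qv) (f g : {lrmorphism Uq -> A}),
    (forall i, f (Eg i) = g (Eg i)) -> (forall i, f (Fg i) = g (Fg i)) ->
    (forall h, f (Kg h) = g (Kg h)) -> f =1 g
}.

Variable U : quantized_enveloping.

Definition Ki (i : 'I_r) : U := Kg U ((dd rd i)%:Z *: coalpha rd i).
Definition Kiinv (i : 'I_r) : U := Kg U (- ((dd rd i)%:Z *: coalpha rd i)).

Definition Uminus : U -> Prop :=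
  gen_subalg anyQv (fun x => exists i, x = Fg U i).

(** [homog mu x]: [x] lies in the component of weight [mu] of [U_q^-]. *)
Inductive homog : P -> U -> Prop :=
| homog_one : homog 0 1
| homog_F i mu x of homog mu x : homog (mu - alpha rd i) (Fg U i * x)
| homog_add mu x y of homog mu x & homog mu y : homog mu (x + y)
| homog_scale c mu x of homog mu x : homog mu (c *: x).

(** [T i] is the braid group automorphism [T_i^-1]. *)
Definition is_braid_inv (T : 'I_r -> U -> U) : Prop :=
  forall i,
  [/\ alg_iso (T i),
      forall h, T i (Kg U h) = Kg U (cosref i h),
      T i (Eg U i) = - (Kiinv i * Fg U i) /\ T i (Fg U i) = - (Eg U i * Ki i),
      forall j, j != i -> let m := `|cartan i j|%N in
        T i (Eg U j) = \sum_(a < m.+1) ((-1) ^+ a * qi i ^- a) *: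
          (divpow i a (Eg U i) * Eg U j * divpow i (m - a) (Eg U i))
    & forall j, j != i -> let m := `|cartan i j|%N in
        T i (Fg U j) = \sum_(a < m.+1) ((-1) ^+ a * qi i ^+ a) *:
          (divpow i (m - a) (Fg U i) * Fg U j * divpow i a (Fg U i))].

(** The ring anti-automorphism [psi] of [U_q^-]; being additive it is Q-linear,
    and it inverts [v = q^(1/2)]. *)
Definition is_psi (psi : U -> U) : Prop :=
  [/\ psi 1 = 1,
      forall x y, Uminus x -> Uminus y -> psi (x + y) = psi x + psi y,
      forall x y, Uminus x -> Uminus y -> psi (x * y) = psi y * psi x,
      forall x, Uminus x -> psi (v *: x) = v^-1 *: psi x
    & forall i, psi (Fg U i) = Fg U i].

(** The sign is [(-1)^Tr(mu)], for [mu = sum_i c_i alpha_i]. *)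
Definition is_dual_bar (psi sigma : U -> U) : Prop :=
  (forall x y, Uminus x -> Uminus y -> sigma (x + y) = sigma x + sigma y) /\
  forall (c : 'I_r -> int) x, let mu := \sum_i c i *: alpha rd i in
    homog mu x ->
    sigma x = ((-1) ^ (\sum_i c i)
               * qpow (form mu mu / 2%:R - form mu rho)) *: psi x.

Variables (l : nat) (iw : l.-tuple 'I_r).

Notation word := (tnth iw).
Notation cvec := {ffun 'I_l -> nat}.

(** [snext k] is [s(k)], where the value [l] stands for [+oo]; the condition
    [j = p(k)] reads [snext j = k]. *)
Definition snext (k : 'I_l) : nat :=
  \big[minn/l]_(j < l | (k < j)%N && (word j == word k)) j.

Definition ufw : {set 'I_l} := [set k | (snext k < l)%N].

(** [k[1] = s(k)] as an index, for [k] unfrozen. *)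
Definition kone (k : 'I_l) : 'I_l := insubd k (snext k).

Definition kmin (k : 'I_l) : 'I_l := [arg min_(j < k | word j == word k) j].
Definition kmax (k : 'I_l) : 'I_l := [arg max_(j > k | word j == word k) j].

Definition beta (k : 'I_l) : P := wact (take k iw) (alpha rd (word k)).

Definition in_interval (j k s : 'I_l) : bool :=
  (j <= s <= k)%N && (word s == word j).

Definition betaI (j k : 'I_l) : P := \sum_(s | in_interval j k s) beta s.

Definition cI (j k : 'I_l) : cvec := [ffun s => nat_of_bool (in_interval j k s)].

Definition unitvec (k : 'I_l) : cvec := [ffun s => nat_of_bool (s == k)].

Definition Nform (c c' : cvec) : rat :=
  \sum_(a < l) \sum_(b < l | (b < a)%N)
     form (beta a) (beta b) * (c a)%:R * (c' b)%:R
  - \sum_(a < l) \sum_(b < l | (a < b)%N)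
     form (beta a) (beta b) * (c a)%:R * (c' b)%:R.

(** [Nform] is integer-valued, so that [Num.floor] merely casts it to [int]. *)
Definition t0 : seed ufw := {|
  bmat := fun j k0 => let k := val k0 in
    if snext j == k then 1
    else if (j : nat) == snext k then - 1
    else if (j < k < snext j)%N && (snext j < snext k)%N
         then cartan (word j) (word k)
    else if (k < j < snext k)%N && (snext k < snext j)%N
         then - cartan (word j) (word k)
    else 0;
  Lam := fun j k => Num.floor (Nform (cI (kmin j) j) (cI (kmin k) k)) |}.

Section Unipotent.

Variable T : 'I_r -> U -> U.

Definition Froot (k : 'I_l) (m : nat) : U :=
  foldr T (divpow (word k) m (Fg U (word k))) (take k iw).

Definition Fpbw (c : cvec) : U :=
  \prod_(k <- rev (enum 'I_l)) Froot k (c k).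

Definition Fup (c : cvec) : U :=
  (\prod_(k < l) \prod_(1 <= s < (c k).+1) (1 - qi (word k) ^+ (2 * s))) *:
    Fpbw c.

(** [A] is the quantum unipotent subgroup [A_q[N_-(w)]]. *)
Definition is_unipotent_subalgebra (A : U -> Prop) : Prop :=
  [/\ A 1, forall x y, A x -> A y -> A (x * y),
      forall x, A x -> Uminus x & is_basis Fpbw A].

Definition prec (c' c : cvec) : Prop :=
  (exists k : 'I_l, (c' k < c k)%N /\ forall j : 'I_l, (j < k)%N -> c' j = c j) /\
  (exists k : 'I_l, (c' k < c k)%N /\ forall j : 'I_l, (k < j)%N -> c' j = c j).

Definition is_dual_canonical (A : U -> Prop) (sigma : U -> U) (B : cvec -> U) :
    Prop :=
  [/\ is_basis B A, forall c, sigma (B c) = B c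
    & forall c, lincomb qZq (prec^~ c) Fup (B c - Fup c)].

End Unipotent.

Section Cell.

Variables (T : 'I_r -> U -> U) (A : U -> Prop) (B : cvec -> U).

(** [D[j,k]], for [j <= k] with the same letter. *)
Definition D (j k : 'I_l) : U := B (cI j k).

Inductive denominator : U -> Prop :=
| den_one : denominator 1
| den_mul k s of denominator s : denominator (D (kmin k) (kmax k) * s).

(** The Ore localization of [A] at the elements [D[k^min,k^max]], i.e. the
    quantum unipotent cell [A_q[N_-^w]]. *)
Record unipotent_cell := UnipotentCell {
  cell :> unitAlgType Qv;
  iota : U -> cell;
  iota_morph : alg_morph_on anyQv A iota;
  iota_inj : forall x y, A x -> A y -> iota x = iota y -> x = y;
  iota_unit : forall k, iota (D (kmin k) (kmax k)) \is a GRing.unit;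
  cell_fractions : forall z : cell, exists a s,
    [/\ A a, denominator s & z = iota a / iota s]
}.

Variable L : unipotent_cell.

Definition DL (j k : 'I_l) : L := iota L (D j k).

Definition cell_homog (mu : P) (z : L) : Prop :=
  exists a s mu1 mu2, [/\ A a /\ homog mu1 a, denominator s /\ homog mu2 s,
    mu = mu1 - mu2 & z = iota L a / iota L s].

Definition cell_int : L -> Prop :=
  gen_subalg Zv (fun z : L =>
    (exists k, z = iota L (Fup T (unitvec k)))
    \/ (exists k, z = (DL (kmin k) (kmax k))^-1)).

(** The rescaling [cor] on the component of weight [mu]. *)
Definition cor (mu : P) (z : L) : L :=
  qpow (- form mu mu / 4%:R + form mu rho / 2%:R) *: z.

(** [D[j,k]] has weight [- beta_[j,k]]. *)
Definition corD (j k : 'I_l) : L := cor (- betaI j k) (DL j k).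

Definition is_kimura_oya (eta : L -> L) : Prop :=
  [/\ alg_iso eta,
      forall k, k \in ufw ->
        eta (DL (kmin k) k)
        = qpow (- form (varpi rd (word k)) (- betaI (kmin k) k)) *:
            ((DL (kmin k) (kmax k))^-1 * DL (kone k) (kmax k))
    & forall k,
        eta (DL (kmin k) (kmax k))^-1
        = qpow (form (varpi rd (word k)) (- betaI (kmin k) (kmax k))) *:
            DL (kmin k) (kmax k)].

Definition is_tw (eta tw : L -> L) : Prop :=
  linear tw /\
  forall mu z, cell_homog mu z -> tw z = eta (qpow (- form mu rho) *: z).

Variable F : forall t : seed ufw, torus_skewfield t.

Definition is_cluster_iso (kappa : F t0 -> L) : Prop :=
  alg_iso_on Zv (cluster_algebra (F := F) (t := t0)) cell_int kappa /\
  forall j, kappa (clvar F t0 j) = corD (kmin j) j.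

(** [twF] is [tw] transported along [kappa] and extended to [F(t0)]. *)
Definition is_transported (kappa : F t0 -> L) (tw : L -> L)
    (twF : F t0 -> F t0) : Prop :=
  alg_iso twF /\
  forall x, cluster_algebra (F := F) (t := t0) x ->
    cluster_algebra (F := F) (t := t0) (twF x) /\ kappa (twF x) = tw (kappa x).

End Cell.

End RootDatum.

(* Main.v *)
(** The map [var := mu^-1 o tw_w] is an isomorphism sending [X_k] to
    [X_(k^max)^-1 * X_(sigma k)] for [k] unfrozen and [X_j] to [X_j^-1] for [j]
    frozen, on the nose: the powers of [v] agree because
    [(beta, beta) = 2 (varpi_i, beta)] for [beta = varpi_i - w' varpi_i].  Hence
    [var] maps monomials to monomials, and [var (Y_k)] is [Y_(sigma k)] times a
    frozen monomial [X^p].  To see [p = 0], two facts are played against each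
    other.  First, [X^p] is central, since both sides of [var (Y_k) ~ Y_(sigma k)]
    commute in the same way with all variables.  Secondly, [X^p] has weight zero:
    the weight grading of [A_q[N_-^w]] makes the exchange relations of [t_0]
    homogeneous, this persists under mutation, and [var] negates weights.  With
    [vp = sum_j p_j varpi_(i_j)], weight zero says [w vp = vp] and centrality says
    that [vp + w vp] is orthogonal to all [beta_b]; so [vp] is orthogonal to every
    [alpha_(i_b)], and [p = 0]. *)
From HB Require Import structures.
Require Import Defs.
From mathcomp Require Import all_boot all_order perm all_algebra.
From mathcomp Require Import ring lra zify.
Set Implicit Arguments.
Unset Strict Implicit.
Unset Printing Implicit Defensive.
Import Order.TTheory GRing.Theory Num.Theory.
Local Open Scope ring_scope.

Lemma v_neq0 : v != 0.
Proof. by rewrite /v tofrac_eq0 polyX_eq0. Qed.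

Lemma q_neq0 : q != 0.
Proof. by rewrite /q expf_neq0 // v_neq0. Qed.

Lemma vnat_eq1 (n : nat) : v ^+ n = 1 -> n = 0%N.
Proof.
rewrite /v -rmorphXn /= -tofrac1 => /eqP.
rewrite tofrac_eq => /eqP /(congr1 (fun p : {poly rat} => size p)).
by rewrite size_polyXn size_poly1 => -[].
Qed.

Lemma vexp_inj : injective (fun n : int => v ^ n).
Proof.
move=> a b /eqP; wlog ab : a b / a <= b => [H E|].
  by case/orP: (le_total a b) => [/H|/H ba]; [exact|rewrite (ba _) // eq_sym].
have -> : b = a + `|b - a|%N by lia.
rewrite expfzDr ?v_neq0 // -[X in X == _]mulr1 (inj_eq (mulfI _)); last first.
  by rewrite expfz_neq0 // v_neq0.
by rewrite eq_sym -exprnP => /eqP/vnat_eq1 ->; rewrite addr0.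
Qed.

Lemma qexpE (n : int) : q ^ n = v ^ (2 * n).
Proof. by rewrite /q exprnP -exprz_exp. Qed.

Lemma qexp_inj : injective (fun n : int => q ^ n).
Proof. by move=> a b /=; rewrite !qexpE => /vexp_inj; lia. Qed.

Lemma qpowE (x : rat) (n : int) : x = n%:~R / 2%:R -> qpow x = v ^ n.
Proof.
move=> ->; rewrite /qpow; congr (v ^ _).
by rewrite mulrC divfK ?intrKfloor // pnatr_eq0.
Qed.

Lemma Zv_v (n : int) : Zv (v ^ n).
Proof.
case: n => n.
  exists 'X^n, 0%N; rewrite expr0 divr1 map_polyXn /v rmorphXn /=.
  by rewrite -exprnP.
exists 1, n.+1; by rewrite rmorph1 tofrac1 mul1r NegzE -exprnN.
Qed.

Lemma Zv0 : Zv 0. Proof. by exists 0, 0%N; rewrite rmorph0 tofrac0 mul0r. Qed.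

Lemma Zv1 : Zv 1. Proof. exact: (Zv_v 0). Qed.

Lemma Zv_mul a b : Zv a -> Zv b -> Zv (a * b).
Proof.
move=> [p [n ->]] [p' [n' ->]]; exists (p * p'), (n + n')%N.
by rewrite rmorphM tofracM exprD invfM mulrACA.
Qed.

Lemma Zv_add a b : Zv a -> Zv b -> Zv (a + b).
Proof.
move=> [p [n ->]] [p' [n' ->]]; exists (p * 'X^n' + p' * 'X^n), (n + n')%N.
rewrite (rmorphD (map_poly intr)) !(rmorphM (map_poly intr)) /=.
rewrite !map_polyXn tofracD !tofracM /= !tofracXn -/v.
rewrite mulrDl exprD.
have vn k : v ^+ k != 0 by rewrite expf_neq0 // v_neq0.
rewrite !invfM; congr (_ + _).
  by rewrite mulrACA mulfV ?mulr1.
by rewrite [_^-1 * _]mulrC mulrACA mulfV ?mulr1.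
Qed.

Lemma Zv_opp a : Zv a -> Zv (- a).
Proof.
by move=> [p [n ->]]; exists (- p), n; rewrite rmorphN tofracN mulNr.
Qed.

Section Lincomb.
Variables (R : Qv -> Prop) (V : lmodType Qv) (J : eqType) (f : J -> V).

Lemma lincomb0 (P : J -> Prop) : lincomb R P f 0.
Proof. by exists [::], (fun=> 0); split=> //; rewrite big_nil. Qed.

Hypothesis R0 : R 0.
Hypothesis RD : forall a b, R a -> R b -> R (a + b).

Lemma lincomb_uniq (P : J -> Prop) x : lincomb R P f x ->
  exists (s : seq J) (c : J -> Qv), [/\ uniq s, forall j, j \in s -> P j,
    forall j, R (c j), forall j, j \notin s -> c j = 0 & x = \sum_(j <- s) c j *: f j].
Proof.
move=> [s [c [sP ->]]].
exists (undup s), (fun j => if j \in s then c j *+ count_mem j s else 0).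
split=> [|j|j|j|]; rewrite ?undup_uniq ?mem_undup //.
- by move/sP=> [].
- case: ifP => // /sP [_ Rc].
  by elim: (count _ _) => [|n IH]; rewrite ?mulr0n ?mulrS //; apply: RD.
- by move/negbTE->.
rewrite [RHS](eq_big_seq (fun j => \sum_(i <- s | i == j) c j *: f j)); last first.
  move=> j; rewrite mem_undup => js /=; rewrite js -big_filter.
  rewrite big_const_seq count_predT size_filter iter_addr_0 -scalerMnl.
  by congr (_ *+ _); apply: eq_count.
rewrite (exchange_big_dep xpredT) //=; apply: eq_big_seq => i is_.
rewrite (eq_bigr (fun=> c i *: f i)) => [|j /eqP -> //].
rewrite (eq_bigl (pred1 i)) => [|j]; last by rewrite /= eq_sym.
by rewrite -big_filter filter_pred1_uniq ?undup_uniq ?mem_undup // big_seq1.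
Qed.

Lemma lincombD (P : J -> Prop) x y :
  lincomb R P f x -> lincomb R P f y -> lincomb R P f (x + y).
Proof.
move=> /lincomb_uniq [s [c [us sP Rc c0 ->]]] /lincomb_uniq [s' [c' [us' sP' Rc' c0' ->]]].
exists (undup (s ++ s')), (fun j => c j + c' j); split.
  move=> j; rewrite mem_undup mem_cat => js; split; last exact: RD.
  by case/orP: js => [/sP|/sP'].
under [RHS]eq_bigr do rewrite scalerDl.
rewrite big_split /=; congr (_ + _).
- rewrite [RHS](bigID (mem s)) /= [X in _ = _ + X]big1 ?addr0; last first.
    by move=> j /c0 ->; rewrite scale0r.
  rewrite -[RHS]big_filter; apply: perm_big; apply: uniq_perm => //.
    by rewrite filter_uniq ?undup_uniq.
  by move=> j; rewrite mem_filter mem_undup mem_cat; case: (j \in s).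
- rewrite [RHS](bigID (mem s')) /= [X in _ = _ + X]big1 ?addr0; last first.
    by move=> j /c0' ->; rewrite scale0r.
  rewrite -[RHS]big_filter; apply: perm_big; apply: uniq_perm => //.
    by rewrite filter_uniq ?undup_uniq.
  by move=> j; rewrite mem_filter mem_undup mem_cat; case: (j \in s'); rewrite ?orbT.
Qed.

End Lincomb.

Section LincombMore.
Variables (V : lmodType Qv) (J : eqType) (f : J -> V).

Lemma lincomb_ind (R : Qv -> Prop) (P : J -> Prop) (Q : V -> Prop) :
  Q 0 -> (forall x y, Q x -> Q y -> Q (x + y)) ->
  (forall c j, R c -> P j -> Q (c *: f j)) ->
  forall x, lincomb R P f x -> Q x.
Proof.
move=> Q0 QD Qf x [s [c [sP ->]]]; elim: s sP => [|j s IH] sP.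
  by rewrite big_nil.
rewrite big_cons; apply: QD.
  by have [Pj Rj] := sP _ (mem_head j s); apply: Qf.
by apply: IH => i is_; apply: sP; rewrite inE is_ orbT.
Qed.

Lemma lincomb1 (R : Qv -> Prop) (P : J -> Prop) c j :
  R c -> P j -> lincomb R P f (c *: f j).
Proof.
move=> Rc Pj; exists [:: j], (fun=> c); split; last by rewrite big_seq1.
by move=> i; rewrite inE => /eqP ->.
Qed.

Lemma lincomb_sub (R R' : Qv -> Prop) (P P' : J -> Prop) x :
  (forall c, R c -> R' c) -> (forall j, P j -> P' j) ->
  lincomb R P f x -> lincomb R' P' f x.
Proof.
move=> RR PP [s [c [sP ->]]]; exists s, c; split=> // j /sP[Pj Rj].
by split; [exact: PP|exact: RR].
Qed.

Lemma lincomb_split (R : Qv -> Prop) (p : pred J) x :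
  lincomb R (fun=> True) f x ->
  exists y z, [/\ lincomb R p f y, lincomb R (fun j => ~~ p j) f z & x = y + z].
Proof.
move=> [s [c [sP ->]]].
exists (\sum_(j <- s | p j) c j *: f j), (\sum_(j <- s | ~~ p j) c j *: f j).
split; last exact: bigID.
- exists (filter p s), c; rewrite big_filter; split=> // j.
  by rewrite mem_filter => /andP[pj /sP[]].
- exists (filter (predC p) s), c; rewrite big_filter; split=> // j.
  by rewrite mem_filter => /andP[pj /sP[]].
Qed.

Lemma lincomb_disjoint (R : Qv -> Prop) (p : pred J) x : lin_indep f ->
  lincomb R p f x -> lincomb R (fun j => ~~ p j) f x -> x = 0.
Proof.
have D a b : anyQv a -> anyQv b -> anyQv (a + b) by [].
move=> fI /(@lincomb_sub _ anyQv _ p) H /(@lincomb_sub _ anyQv _ (fun j => ~~ p j)) H'.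
have := H (fun=> fun=> I) (fun=> id).
move=> /(lincomb_uniq _ D) [//|s [c [us sP _ _ Ex]]].
move=> /(_ (fun=> fun=> I) (fun=> id)) in H'.
have [//|s' [c' [us' sP' _ _ E]]] := lincomb_uniq _ D H'.
move=> {H H'}.
pose d j := if p j then c j else - c' j.
have dE : \sum_(j <- s ++ s') d j *: f j = 0.
  rewrite big_cat /= (eq_big_seq (fun j => c j *: f j)) => [|j /sP pj]; last first.
    by rewrite /d pj.
  rewrite [X in _ + X](eq_big_seq (fun j => - (c' j *: f j))) => [|j /sP' pj]; last first.
    by rewrite /d (negbTE pj) scaleNr.
  by rewrite sumrN -E -Ex subrr.
have u : uniq (s ++ s').
  rewrite cat_uniq us us' andbT /=; apply/hasPn => j /sP' pj.
  by apply/negP => /sP; rewrite (negbTE pj).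
have c0 := fI _ _ u dE.
rewrite Ex big_seq big1 // => j js; have := c0 j; rewrite mem_cat js => /(_ isT).
by rewrite /d sP // => ->; rewrite scale0r.
Qed.

Lemma lincombZ (R : Qv -> Prop) (P : J -> Prop) k x :
  (forall a, R a -> R (k * a)) -> lincomb R P f x -> lincomb R P f (k *: x).
Proof.
move=> Rk [s [c [sP ->]]]; exists s, (fun j => k * c j); split.
  by move=> j /sP [? /Rk].
by rewrite scaler_sumr; apply: eq_bigr => j _; rewrite scalerA.
Qed.

End LincombMore.

(** * Seeds and their mutations *)

Section LinearExtension.
Variables (I : finType) (V : zmodType).

Definition linext (om : I -> V) (m : {ffun I -> int}) : V := \sum_i om i *~ m i.

Variable om : I -> V.

Lemma linext_is_zmod_morphism : zmod_morphism (linext om).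
Proof.
move=> m m'; rewrite /linext -sumrB; apply: eq_bigr => i _.
by rewrite !ffunE mulrzBr.
Qed.
HB.instance Definition _ :=
  GRing.isZmodMorphism.Build _ _ (linext om) linext_is_zmod_morphism.

Lemma linext_fvec i : linext om (fvec i) = om i.
Proof.
rewrite /linext (bigD1 i) //= ffunE eqxx big1 ?addr0 // => j ji.
by rewrite ffunE (negbTE ji).
Qed.

Lemma eq_linext om' m : om =1 om' -> linext om m = linext om' m.
Proof. by move=> E; apply: eq_bigr => i _; rewrite E. Qed.

End LinearExtension.

Section Seeds.
Variables (I : finType) (uf : {set I}).
Notation expo := {ffun I -> int}.
Notation seed := (seed uf).
Notation unfrozen := (unfrozen uf).
Implicit Types (t : seed) (m : expo) (k : unfrozen).

Lemma ffunMzE (g : expo) n i : (g *~ n) i = g i * n.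
Proof.
have E a : (g *~ Posz a) i = g i * a.
  elim: a => [|a IH]; first by rewrite mulr0z ffunE mulr0.
  by rewrite intS mulrzDr mulr1z ffunE IH mulrDr mulr1.
by case: n => n; rewrite ?NegzE ?mulrNz ?ffunE E ?mulrN.
Qed.

Lemma expoE m : m = linext (@fvec I) m.
Proof.
apply/ffunP => i; rewrite /linext sum_ffunE (bigD1 i) //= big1 ?addr0.
  by rewrite ffunMzE ffunE eqxx mul1r.
by move=> j ji; rewrite ffunMzE ffunE eq_sym (negbTE ji) mul0r.
Qed.

Lemma expo_ind (Q : expo -> Prop) : Q 0 ->
  (forall m i, Q m -> Q (m + fvec i)) -> (forall m i, Q m -> Q (m - fvec i)) ->
  forall m, Q m.
Proof.
move=> Q0 Qp Qm m; rewrite [m]expoE /linext.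
elim: (index_enum I) => [|i s IH]; first by rewrite big_nil.
rewrite big_cons addrC; move: (\sum_(_ <- s) _) IH => x Qx.
case: (m i) => n.
  by elim: n => [|n IH]; rewrite ?mulr0z ?addr0 // intS mulrzDr mulr1z addrCA addrC; apply: Qp.
rewrite NegzE mulrNz.
elim: n => [|n IH]; first by rewrite mulr1z; apply: Qm.
by rewrite intS mulrzDr mulr1z opprD addrCA addrC; apply: Qm.
Qed.

Lemma lamE t m m' : lam t m m' = linext (fun i => linext (Lam t i) m') m.
Proof.
rewrite /lam /linext; apply: eq_bigr => i _.
rewrite -mulrzr intz mulr_suml; apply: eq_bigr => j _.
by rewrite -mulrzr intz; ring.
Qed.

Lemma lamDl t m1 m2 m : lam t (m1 + m2) m = lam t m1 m + lam t m2 m.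
Proof. by rewrite !lamE raddfD. Qed.
Lemma lamNl t m1 m : lam t (- m1) m = - lam t m1 m.
Proof. by rewrite !lamE raddfN. Qed.
Lemma lamMzl t m1 m n : lam t (m1 *~ n) m = lam t m1 m * n.
Proof. by rewrite !lamE raddfMz -mulrzr intz. Qed.

Definition skew_seed t := forall i j, Lam t i j = - Lam t j i.

Lemma lamC t m m' : skew_seed t -> lam t m m' = - lam t m' m.
Proof.
move=> sk; rewrite /lam exchange_big /= -sumrN; apply: eq_bigr => i _.
by rewrite -sumrN; apply: eq_bigr => j _; rewrite sk; ring.
Qed.

Lemma lamDr t m1 m2 m : lam t m (m1 + m2) = lam t m m1 + lam t m m2.
Proof.
rewrite /lam -big_split; apply: eq_bigr => i _.
by rewrite -big_split; apply: eq_bigr => j _; rewrite ffunE mulrDr.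
Qed.

Lemma lam0r t m : lam t m 0 = 0.
Proof. by have := lamDr t 0 0 m; rewrite addr0; lia. Qed.

Lemma lamNr t m1 m : lam t m (- m1) = - lam t m m1.
Proof. by have := lamDr t m1 (- m1) m; rewrite subrr lam0r; lia. Qed.

Lemma lamm t m : skew_seed t -> lam t m m = 0.
Proof. by move=> sk; have := lamC m m sk; lia. Qed.

Lemma lam_fvec t i j : lam t (fvec i) (fvec j) = Lam t i j.
Proof. by rewrite lamE !linext_fvec. Qed.

Lemma lam_linextl t (om : I -> expo) m m' :
  lam t (linext om m) m' = linext (fun i => lam t (om i) m') m.
Proof.
move: m; apply: expo_ind => [|m i E|m i E].
- by rewrite !raddf0 lamE raddf0.
- by rewrite !raddfD /= lamDl E !linext_fvec.
- by rewrite !raddfB /= lamDl lamNl E !linext_fvec.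
Qed.

Lemma lam_linextr t (om : I -> expo) m m' :
  lam t m (linext om m') = linext (fun j => lam t m (om j)) m'.
Proof.
move: m'; apply: expo_ind => [|m' i E|m' i E].
- by rewrite !raddf0 lam0r.
- by rewrite !raddfD /= lamDr E !linext_fvec.
- by rewrite !raddfB /= lamDr lamNr E !linext_fvec.
Qed.

Definition Bcol t k : expo := \sum_i fvec i *~ bmat t i k.

Lemma BcolE t k i : Bcol t k i = bmat t i k.
Proof.
have := expoE [ffun i => bmat t i k] => /ffunP /(_ i); rewrite ffunE => ->.
by rewrite /Bcol /linext; congr (fun_of_fin _ i); apply: eq_bigr => j _; rewrite ffunE.
Qed.

Lemma lam_Bcol_fvec t k j :
  lam t (Bcol t k) (fvec j) = \sum_i bmat t i k * Lam t i j.
Proof.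
rewrite lamE {1}/linext; apply: eq_bigr => i _.
by rewrite linext_fvec BcolE mulrzz mulrC.
Qed.

Definition compat t (d : unfrozen -> int) :=
  skew_seed t /\ forall k j, lam t (Bcol t k) (fvec j) = if j == val k then d k else 0.

Lemma fmutE eps t k i :
  fmut eps t k i = - (i == val k)%:Z + pospart (eps * bmat t i k).
Proof.
rewrite /fmut !ffunE sum_ffunE (bigD1 i) //= big1 ?addr0.
  by rewrite ffunMzE ffunE eqxx mul1r.
by move=> j ji; rewrite ffunMzE ffunE eq_sym (negbTE ji) mul0r.
Qed.

Lemma fmut_diff t k : fmut 1 t k - fmut (- 1) t k = Bcol t k.
Proof.
apply/ffunP => i; rewrite ffunE [X in _ + X]ffunE !fmutE BcolE /pospart mul1r mulN1r; lia.
Qed.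

Definition mutbase t k i : expo := if i == val k then fmut (- 1) t k else fvec i.

Definition mutlin t k : expo -> expo := linext (mutbase t k).

Lemma mutlinE t k m i :
  mutlin t k m i = (if i == val k then 0 else m i) + m (val k) * fmut (- 1) t k i.
Proof.
rewrite /mutlin /linext sum_ffunE (bigD1 (val k)) //= ffunMzE /mutbase eqxx addrC.
rewrite [X in _ + X]mulrC; congr (_ + _).
rewrite (eq_bigr (fun j => (j == i)%:Z * m j)) => [|j jk]; last first.
  by rewrite (negbTE jk) ffunMzE ffunE eq_sym.
case: eqP => [ik|/eqP ik].
  by apply: big1 => j jk; rewrite ik (negbTE jk) mul0r.
rewrite (bigD1 i) //= eqxx mul1r big1 ?addr0 // => j /andP[_ ji].
by rewrite (negbTE ji) mul0r.
Qed.

Lemma lam_mutate t k m m' :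
  lam (mutate t k) m m' = lam t (mutlin t k m) (mutlin t k m').
Proof.
rewrite lamE /mutlin lam_linextl; apply: eq_linext => i.
by rewrite lam_linextr; apply: eq_linext => j.
Qed.

Lemma lam_BcolBcol t d k j : compat t d ->
  lam t (Bcol t k) (Bcol t j) = d k * bmat t (val k) j.
Proof.
move=> [_ dB]; rewrite [X in lam t _ X]expoE lam_linextr /linext.
rewrite (bigD1 (val k)) //= big1 => [|i ik]; last first.
  by rewrite dB (negbTE ik) mul0rz.
by rewrite dB eqxx BcolE addr0 -mulrzr intz.
Qed.

Definition dpos (d : unfrozen -> int) := forall k, 0 < d k.

Lemma compat_bmat t d k j : compat t d ->
  d k * bmat t (val k) j = - (d j * bmat t (val j) k).
Proof.
move=> c; rewrite -!(lam_BcolBcol _ _ c) lamC //; exact: c.1.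
Qed.

Lemma compat_bmat0 t d k : dpos d -> compat t d -> bmat t (val k) k = 0.
Proof. move=> dp /(compat_bmat k k); have := dp k; nia. Qed.

Lemma mutlin_Bcol t d k j : dpos d -> compat t d ->
  mutlin t k (Bcol (mutate t k) j)
  = if j == k then - Bcol t k else Bcol t j + Bcol t k *~ pospart (bmat t (val k) j).
Proof.
move=> dp c; have b0 := compat_bmat0 k dp c.
apply/ffunP => i; rewrite mutlinE !BcolE /= !eqxx /= fmutE.
case: (eqVneq j k) => [->|jk]; rewrite !ffunE ?BcolE ?ffunMzE ?BcolE ?orbT ?orbF.
  by rewrite b0; case: eqP => [->|_]; rewrite ?b0; lia.
by case: eqP => [->|_] /=; rewrite ?b0 /pospart; lia.
Qed.

Lemma compat_mutate t d k : dpos d -> compat t d -> compat (mutate t k) d.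
Proof.
move=> dp c; have [sk dB] := c; split=> [i j /=|j i]; first exact: lamC.
rewrite lam_mutate (mutlin_Bcol _ _ dp c) /mutlin linext_fvec /mutbase.
have b0 := compat_bmat0 k dp c.
have dBm j' : lam t (Bcol t j') (fmut (- 1) t k)
    = if j' == k then - d k else pospart (- bmat t (val j') k) * d j'.
  rewrite [X in lam t _ X]expoE lam_linextr /linext (bigD1 (val j')) //= big1.
    rewrite addr0 dB eqxx -mulrzr intz fmutE (inj_eq val_inj).
    by case: eqP => [->|_]; rewrite ?b0 /pospart ?mulN1r; lia.
  by move=> i' ij; rewrite dB (negbTE ij) mul0rz.
case: (eqVneq j k) => [->|jk]; rewrite ?lamNl ?lamDl ?lamMzl.
  case: (eqVneq i (val k)) => [_|ik]; first by rewrite dBm eqxx opprK.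
  by rewrite dB (negbTE ik) oppr0.
case: (eqVneq i (val k)) => [->|ik].
  rewrite !dBm eqxx (negbTE jk) (inj_eq val_inj) eq_sym (negbTE jk).
  have := compat_bmat k j c; have := dp k; have := dp j; rewrite /pospart.
  case: (lerP 0 (bmat t (val k) j)); case: (lerP (- bmat t (val j) k) 0); nia.
by rewrite !dB (negbTE ik) mul0r addr0.
Qed.

End Seeds.

(** * Homogeneous fractions over a quantum torus *)

Lemma scale_vM (A : lalgType Qv) (a b : int) (x : A) :
  v ^ a *: (v ^ b *: x) = v ^ (a + b) *: x.
Proof. by rewrite scalerA expfzDr ?v_neq0. Qed.

Lemma scale_v_inj (A : lmodType Qv) (a b : int) (x : A) : x != 0 ->
  v ^ a *: x = v ^ b *: x -> a = b.
Proof.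
move=> x0 /eqP; rewrite -subr_eq0 -scalerBl scaler_eq0 (negbTE x0) orbF subr_eq0.
by move/eqP/vexp_inj.
Qed.

Section Torus.
Variables (I : finType) (uf : {set I}) (t : seed uf) (TF : torus_skewfield t).
Notation X := (Defs.X TF).
Hypothesis sk : skew_seed t.

Lemma X_neq0 m : X m != 0.
Proof.
apply/negP => /eqP E; have := @X_indep _ _ _ TF [:: m] (fun=> 1).
rewrite big_seq1 E scaler0 => /(_ isT erefl m); rewrite inE eqxx => /(_ isT)/eqP.
by rewrite oner_eq0.
Qed.

Lemma X_unit m : X m \is a GRing.unit.
Proof. exact/skf_division/X_neq0. Qed.

Lemma X_zero : X 0 = 1.
Proof.
apply: (mulrI (X_unit 0)); rewrite mulr1 X_mul lam0r expr0z scale1r.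
by rewrite addr0.
Qed.

Lemma X_inv m : (X m)^-1 = X (- m).
Proof.
apply: (mulrI (X_unit m)); rewrite divrr ?X_unit //.
by rewrite X_mul lamNr lamm // oppr0 expr0z scale1r subrr X_zero.
Qed.

Lemma X_comm m m' : X m * X m' = v ^ (2 * lam t m m') *: (X m' * X m).
Proof.
rewrite !X_mul scale_vM addrC [m' + m]addrC; congr (v ^ _ *: _).
by rewrite [lam t m' m]lamC //; ring.
Qed.

Lemma XD m m' : X (m + m') = v ^ (- lam t m m') *: (X m * X m').
Proof. by rewrite X_mul scale_vM addNr expr0z scale1r. Qed.

Lemma skf_mulf_eq0 (x y : TF) : x * y = 0 -> y != 0 -> x = 0.
Proof.
move=> E /skf_division y0; apply: (mulIr y0); by rewrite mul0r.
Qed.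

Lemma skf_mulf_neq0 (x y : TF) : x != 0 -> y != 0 -> x * y != 0.
Proof. by move=> x0 y0; apply: contraNneq x0 => /skf_mulf_eq0 ->. Qed.

Section Graded.
Variables (V : zmodType) (om : I -> V).
Notation wt := (linext om).

Definition torus_homog (al : V) (a : TF) : Prop := lincomb Zv (fun m => wt m == al) X a.

Lemma torus_homogX m : torus_homog (wt m) (X m).
Proof. by rewrite -[X m]scale1r; apply: lincomb1; rewrite ?eqxx //; apply: Zv1. Qed.

Lemma torus_homogD al a b :
  torus_homog al a -> torus_homog al b -> torus_homog al (a + b).
Proof. by move=> ha hb; apply: (lincombD Zv0 Zv_add ha hb). Qed.

Lemma torus_homogM al be a b :
  torus_homog al a -> torus_homog be b -> torus_homog (al + be) (a * b).
Proof.
move=> ha hb; move: a ha; apply: lincomb_ind => [|x y hx hy|c m Rc /eqP hm].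
- by rewrite mul0r; apply: lincomb0.
- by rewrite mulrDl; apply: torus_homogD.
move: b hb; apply: lincomb_ind => [|x y hx hy|c' m' Rc' /eqP hm'].
- by rewrite mulr0; apply: lincomb0.
- by rewrite mulrDr; apply: torus_homogD.
rewrite -scalerAl -scalerAr X_mul !scalerA; apply: lincomb1.
  by do !apply: Zv_mul => //; apply: Zv_v.
by rewrite /= raddfD /= hm hm' eqxx.
Qed.

Lemma torus_homogN al a : torus_homog al a -> torus_homog al (- a).
Proof.
move=> h; rewrite -scaleN1r; apply: lincombZ h => b /(Zv_mul _); apply.
by apply: Zv_opp; apply: Zv1.
Qed.

Lemma torus_fraction (z : TF) : exists a b : TF,
  [/\ lincomb Zv (fun=> True) X a, lincomb Zv (fun=> True) X b, b != 0 & z = a / b].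
Proof. exact: skf_fractions. Qed.

Lemma torus_component be (b : TF) ga (c : TF) : torus_homog be b ->
  lincomb Zv (fun m => wt m != ga) X c ->
  lincomb Zv (fun m => wt m != be + ga) X (b * c).
Proof.
move=> hb hc; move: b hb; apply: lincomb_ind => [|x y hx hy|k m Rk /eqP hm].
- by rewrite mul0r; apply: lincomb0.
- by rewrite mulrDl; apply: (lincombD Zv0 Zv_add).
move: c hc; apply: lincomb_ind => [|x y hx hy|k' m' Rk' hm'].
- by rewrite mulr0; apply: lincomb0.
- by rewrite mulrDr; apply: (lincombD Zv0 Zv_add).
rewrite -scalerAl -scalerAr X_mul !scalerA; apply: lincomb1.
  by do !apply: Zv_mul => //; apply: Zv_v.
by rewrite /= raddfD /= hm (inj_eq (addrI _)).
Qed.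

(* The Ore condition for homogeneous elements: take a homogeneous component of
   an arbitrary common multiple. *)
Lemma torus_homog_ore al be a b : torus_homog al a -> torus_homog be b ->
  b != 0 -> exists ga de c d, [/\ torus_homog ga c, torus_homog de d, d != 0,
    al + de = be + ga & a * d = b * c].
Proof.
move=> ha hb b0; have [c0 [d0 [hc0 hd0 d0n E]]] := torus_fraction (b^-1 * a).
have {}E : a * d0 = b * c0.
  move: E => /(congr1 (fun z => b * z * d0)).
  by rewrite !mulrA divrr ?mul1r ?divrK ?skf_division //; apply: skf_division.
have [de [d [d' [hd hd' dn Ed]]]] : exists de d d',
    [/\ torus_homog de d, lincomb Zv (fun m => wt m != de) X d', d != 0 & d0 = d + d'].
  have [s [k [us _ Rk _ Ed]]] := lincomb_uniq Zv0 Zv_add hd0.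
  have [i is_ ki] : exists2 i, i \in s & k i != 0.
    apply/hasP; apply: contraNT d0n => /hasPn ks0; rewrite Ed big_seq big1 // => i /ks0.
    by rewrite negbK => /eqP ->; rewrite scale0r.
  have [d [d' [hd hd' Ed']]] := lincomb_split (fun m => wt m == wt i) hd0.
  exists (wt i), d, d'; split=> //; apply/negP => /eqP d0'.
  have sP : lincomb Zv (fun m => wt m != wt i) X d0 by rewrite Ed' d0' add0r.
  have : k i *: X i = 0.
    apply: (lincomb_disjoint (R := Zv) (p := pred1 i)); first exact: X_indep.
      by apply: lincomb1 => //=; apply: eqxx.
    have -> : k i *: X i = d0 - \sum_(j <- s | j != i) k j *: X j.
      by rewrite Ed (bigD1_seq i) //= addrK.
    apply: (lincombD Zv0 Zv_add).
      by apply: lincomb_sub sP => // m; apply: contraNneq => ->.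
    exists [seq j <- s | j != i], (fun j => - k j); split.
      by move=> j; rewrite mem_filter => /andP[ne _]; split=> //; apply: Zv_opp.
    by rewrite big_filter -sumrN; apply: eq_bigr => j _; rewrite scaleNr.
  by move/eqP; rewrite scaler_eq0 (negbTE ki) (negbTE (X_neq0 i)).
have [c [c' [hc hc' Ec]]] := lincomb_split (fun m => wt m == al + de - be) hc0.
exists (al + de - be), de, c, d; split=> //; first by rewrite [RHS]addrC subrK.
apply/eqP; rewrite -subr_eq0; apply/eqP.
apply: (lincomb_disjoint (p := fun m => wt m == al + de)); first exact: X_indep.
  apply: torus_homogD; first exact: torus_homogM.
  apply: torus_homogN; have -> : al + de = be + (al + de - be) by rewrite [RHS]addrC subrK.
  exact: torus_homogM.
have -> : a * d - b * c = b * c' - a * d'.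
  apply/eqP; rewrite subr_eq addrAC eq_sym subr_eq.
  by rewrite -!mulrDr -Ed [c' + c]addrC -Ec E.
apply: (lincombD Zv0 Zv_add).
  have -> : al + de = be + (al + de - be) by rewrite [RHS]addrC subrK.
  exact: torus_component hc'.
rewrite -scaleN1r; apply: lincombZ; last exact: torus_component.
by move=> k; apply: Zv_mul; apply: Zv_opp; apply: Zv1.
Qed.

Definition homog_fraction (mu : V) (z : TF) : Prop :=
  exists al be a b, [/\ torus_homog al a, torus_homog be b, b != 0,
    mu = al - be & z = a / b].

Lemma homog_fraction_torus al a : torus_homog al a -> homog_fraction al a.
Proof.
move=> ha; exists al, 0, a, 1; split; rewrite ?subr0 ?divr1 ?oner_neq0 //.
by rewrite -X_zero; have := torus_homogX 0; rewrite raddf0.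
Qed.

Lemma homog_fractionM mu nu y z :
  homog_fraction mu y -> homog_fraction nu z -> homog_fraction (mu + nu) (y * z).
Proof.
move=> [al [be [a [b [ha hb b0 -> ->]]]]] [al' [be' [a' [b' [ha' hb' b0' -> ->]]]]].
have [ga [de [c [d [hc hd d0 E Ed]]]]] := torus_homog_ore ha' hb b0.
exists (al + ga), (be' + de), (a * c), (b' * d); split.
- exact: torus_homogM.
- exact: torus_homogM.
- exact: skf_mulf_neq0.
- have -> : ga = al' + de - be by rewrite E addrC addKr.
  rewrite [al' + de - be]addrAC opprD [- be' - de]addrC !addrA addrK.
  by congr (_ - _); rewrite addrAC.
- have ub := skf_division b0; have ud := skf_division d0.
  have ub' := skf_division b0'.
  rewrite invrM // -!mulrA; congr (_ * _); rewrite !mulrA; congr (_ * _).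
  by apply: (mulrI ub); rewrite mulrA divrr // mul1r mulrA -Ed mulrK.
Qed.

Lemma homog_fractionD mu y z :
  homog_fraction mu y -> homog_fraction mu z -> homog_fraction mu (y + z).
Proof.
move=> [al [be [a [b [ha hb b0 E ->]]]]] [al' [be' [a' [b' [ha' hb' b0' E' ->]]]]].
have [ga [de [c [d [hc hd d0 Ew Ed]]]]] := torus_homog_ore hb hb' b0'.
have [ub ud] := (skf_division b0, skf_division d0).
have ub' := skf_division b0'.
have c0 : c != 0.
  apply/negP => /eqP c0; have := skf_mulf_neq0 b0 d0; by rewrite Ed c0 mulr0 eqxx.
have uc := skf_division c0.
exists (al + de), (be + de), (a * d + a' * c), (b * d); split.
- apply: torus_homogD; first exact: torus_homogM.
  have -> : al + de = al' + ga.
    have -> : al = mu + be by rewrite E subrK.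
    have -> : al' = mu + be' by rewrite E' subrK.
    by rewrite -!addrA Ew.
  exact: torus_homogM.
- exact: torus_homogM.
- exact: skf_mulf_neq0.
- by rewrite opprD addrACA subrr addr0.
rewrite mulrDl; congr (_ + _); first by rewrite invrM // mulrA mulrK.
by rewrite Ed invrM // mulrA mulrK.
Qed.

Lemma homog_fractionV mu z : homog_fraction mu z -> homog_fraction (- mu) z^-1.
Proof.
move=> [al [be [a [b [ha hb b0 -> ->]]]]].
case: (eqVneq a 0) => [->|a0].
  rewrite mul0r invr0; exists (be - al), 0, 0, 1; split; rewrite ?subr0 ?opprB ?mul0r ?oner_neq0 //.
    exact: lincomb0.
  by rewrite -X_zero; have := torus_homogX 0; rewrite raddf0.
exists be, al, b, a; split; rewrite ?opprB //.
by rewrite invrM ?unitrV ?invrK //; apply: skf_division.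
Qed.

Lemma homog_fractionZ c mu z : Zv c -> homog_fraction mu z -> homog_fraction mu (c *: z).
Proof.
move=> Rc [al [be [a [b [ha hb b0 -> ->]]]]].
exists al, be, (c *: a), b; split; rewrite -?scalerAl //.
by apply: lincombZ ha => k; apply: Zv_mul.
Qed.

End Graded.
End Torus.

Section AlgIso.
Variables (A B : unitAlgType Qv) (f : A -> B).
Hypothesis fiso : alg_iso f.

Lemma alg_isoD x y : f (x + y) = f x + f y.
Proof. by case: fiso => fl _ _; have := fl 1 x y; rewrite !scale1r. Qed.
Lemma alg_iso0 : f 0 = 0.
Proof. by apply: (addrI (f 0)); rewrite -alg_isoD !addr0. Qed.
Lemma alg_isoZ c x : f (c *: x) = c *: f x.
Proof. by case: fiso => fl _ _; have := fl c x 0; rewrite !addr0 alg_iso0 addr0. Qed.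
Lemma alg_iso1 : f 1 = 1.
Proof. by case: fiso => _ []. Qed.
Lemma alg_isoM x y : f (x * y) = f x * f y.
Proof. by case: fiso => _ [_ ->]. Qed.
Lemma alg_iso_inj : injective f.
Proof. by case: fiso => _ _ /bij_inj. Qed.
Lemma alg_iso_unit x : x \is a GRing.unit -> f x \is a GRing.unit.
Proof.
move=> ux; apply/unitrP; exists (f x^-1).
by rewrite -!alg_isoM mulVr // divrr // alg_iso1.
Qed.
Lemma alg_isoV x : x \is a GRing.unit -> f x^-1 = (f x)^-1.
Proof.
move=> ux; apply: (mulrI (alg_iso_unit ux)).
by rewrite -alg_isoM !divrr ?alg_iso_unit // alg_iso1.
Qed.
Lemma alg_iso_neq0 x : x != 0 -> f x != 0.
Proof. by apply: contraNneq => fx; apply/eqP/alg_iso_inj; rewrite fx alg_iso0. Qed.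

Lemma alg_iso_inverse : exists2 g : B -> A, alg_iso g & cancel g f.
Proof.
case: (fiso) => fl fm [g gf fg]; exists g => //; split; last by exists f.
  move=> c x y; apply: alg_iso_inj; rewrite fg fl !fg //.
split; first by apply: alg_iso_inj; rewrite fg alg_iso1.
by move=> x y; apply: alg_iso_inj; rewrite fg alg_isoM !fg.
Qed.

End AlgIso.

Lemma alg_iso_id (A : algType Qv) (f : A -> A) : f =1 id -> alg_iso f.
Proof.
move=> fE; split; first by move=> c x y; rewrite !fE.
  by split; [rewrite fE|move=> x y; rewrite !fE].
by exists id => x; rewrite fE.
Qed.

Lemma alg_iso_comp (A B C : algType Qv) (f : A -> B) (g : B -> C) (h : A -> C) :
  alg_iso f -> alg_iso g -> h =1 g \o f -> alg_iso h.
Proof.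
move=> [fl [f1 fM] fb] [gl [g1 gM] gb] hE; split.
- by move=> c x y; rewrite !hE /= fl gl.
- by split=> [|x y]; rewrite !hE /= ?f1 ?fM ?gM.
- exact: eq_bij (bij_comp gb fb) _ (fun x => esym (hE x)).
Qed.

Section Mutations.
Variables (I : finType) (uf : {set I}).
Variable F : forall t : seed uf, torus_skewfield t.
Notation unfrozen := (unfrozen uf).

Lemma frozen_neq (j : I) (k : unfrozen) : j \notin uf -> j != val k.
Proof. by apply: contraNneq => ->; apply: valP. Qed.

Section Grading.
Variable V : zmodType.
Implicit Types (t : seed uf) (om : I -> V).

Definition graded t om := forall k, linext om (Bcol t k) = 0.

Definition mutgrade t k om : I -> V := fun i => linext om (mutbase t k i).

Lemma linext_mutgrade t k om m :
  linext (mutgrade t k om) m = linext om (mutlin t k m).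
Proof.
rewrite /mutlin; move: m; apply: expo_ind => [|m i E|m i E].
- by rewrite !raddf0.
- by rewrite !raddfD /= E !linext_fvec.
- by rewrite !raddfB /= E !linext_fvec.
Qed.

Lemma graded_mutate t d k om : dpos d -> compat t d -> graded t om ->
  graded (mutate t k) (mutgrade t k om).
Proof.
move=> dp c g j; rewrite linext_mutgrade (mutlin_Bcol _ _ dp c).
by case: eqP => _; rewrite ?raddfN ?raddfD ?raddfMz /= !g ?oppr0 // mul0rz addr0.
Qed.

Lemma mutation_homog t k om (phi : F (mutate t k) -> F t) mu z :
    skew_seed t -> graded t om -> is_mutation_iso phi ->
  homog_fraction (TF := F _) (mutgrade t k om) mu z ->
  homog_fraction (TF := F t) om mu (phi z).
Proof.
move=> sk g [iso phi_i phi_k].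
have sk' : skew_seed (mutate t k) by move=> i j; apply: lamC.
have om_fmut : linext om (fmut 1 t k) = linext om (fmut (- 1) t k).
  by have := g k; rewrite -fmut_diff raddfB /= => /eqP; rewrite subr_eq0 => /eqP.
have phi_f i : homog_fraction (TF := F t) om (mutgrade t k om i) (phi (clvar F _ i)).
  rewrite /mutgrade /mutbase; case: (eqVneq i (val k)) => [->|ik].
    rewrite phi_k; apply: homog_fractionD => //; apply: homog_fraction_torus => //.
      exact: torus_homogX.
    by rewrite -om_fmut; apply: torus_homogX.
  by rewrite phi_i //; apply: homog_fraction_torus => //; apply: torus_homogX.
have phi_X m : homog_fraction (TF := F t) om (linext (mutgrade t k om) m) (phi (X (F _) m)).
  move: m; apply: expo_ind => [|m i E|m i E].
  - rewrite raddf0 X_zero // (alg_iso1 iso) -(X_zero (F t)); apply: homog_fraction_torus => //.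
    by rewrite -[X in torus_homog _ X](raddf0 (linext om)); apply: torus_homogX.
  - rewrite raddfD /= linext_fvec XD (alg_isoZ iso) (alg_isoM iso).
    by apply: homog_fractionZ; [exact: Zv_v|apply: homog_fractionM => //; apply: phi_f].
  - rewrite raddfB /= linext_fvec XD (alg_isoZ iso) (alg_isoM iso).
    apply: homog_fractionZ; first exact: Zv_v.
    apply: homog_fractionM => //; rewrite -X_inv // (alg_isoV iso) ?X_unit //.
    by apply: homog_fractionV => //; apply: phi_f.
have phi_t al a : torus_homog (TF := F _) (mutgrade t k om) al a ->
    homog_fraction (TF := F t) om al (phi a).
  move: a; apply: lincomb_ind => [|x y hx hy|c m Rc /eqP <-].
  - rewrite (alg_iso0 iso); apply: homog_fraction_torus => //; exact: lincomb0.
  - by rewrite (alg_isoD iso); apply: homog_fractionD.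
  - by rewrite (alg_isoZ iso); apply: homog_fractionZ.
move=> [al [be [a [b [ha hb b0 -> ->]]]]].
rewrite (alg_isoM iso) (alg_isoV iso); last exact: (skf_division b0).
by apply: homog_fractionM => //; [apply: phi_t|apply: homog_fractionV; apply: phi_t].
Qed.

Lemma mutseq_homog ks t d om (mu : F (mutseq t ks) -> F t) :
    dpos d -> compat t d -> graded t om -> is_mutseq_iso mu ->
  [/\ alg_iso mu, compat (mutseq t ks) d,
      forall j, j \notin uf -> mu (clvar F _ j) = clvar F t j
    & exists om1, [/\ forall j, j \notin uf -> om1 j = om j,
      graded (mutseq t ks) om1
    & forall al z, homog_fraction (TF := F _) om1 al z ->
        homog_fraction (TF := F t) om al (mu z)]].
Proof.
move=> dp; elim: ks t om mu => [|k ks IH] t om mu c g /=.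
  move=> muE; split; [exact: alg_iso_id|exact: c|by move=> j _; rewrite muE|].
  by exists om; split=> // al z; rewrite muE.
move=> [phi1 [phi2 [iso1 iso2 muE]]].
have c' := compat_mutate k dp c; have g' := graded_mutate k dp c g.
have [a2 c2 f2 [om1 [E1 g1 h1]]] := IH _ _ _ c' g' iso2.
have [a1 f1 _] := iso1.
split=> //.
- exact: alg_iso_comp a2 a1 muE.
- by move=> j ju; rewrite muE /= f2 // f1 // frozen_neq.
exists om1; split=> // [j ju|al z /h1].
  by rewrite E1 // /mutgrade /mutbase (negbTE (frozen_neq k ju)) linext_fvec.
by rewrite muE; apply: mutation_homog => //; apply: c.1.
Qed.

End Grading.
End Mutations.

(** * Root data and reduced words *)

Section Root.
Variables (r : nat) (rd : root_datum r).
Notation P := 'rV[int]_(rkP rd).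
Notation form := (@Defs.form r rd).
Notation sref := (@Defs.sref r rd).
Notation wact := (@Defs.wact r rd).
Implicit Types (x y mu h : P) (i : 'I_r).

Lemma scalezE (V : lmodType int) (n : int) (x : V) : n *: x = x *~ n.
Proof. by rewrite -scaler_int intz. Qed.

Lemma pairing_is_zmod_morphism n (h : 'rV[int]_n) : zmod_morphism (pairing h).
Proof.
move=> x y; rewrite /pairing -sumrB; apply: eq_bigr => a _.
by rewrite !mxE mulrBr.
Qed.
HB.instance Definition _ n (h : 'rV[int]_n) :=
  GRing.isZmodMorphism.Build _ _ (pairing h) (pairing_is_zmod_morphism h).

Lemma pairingC n (h x : 'rV[int]_n) : pairing h x = pairing x h.
Proof. by apply: eq_bigr => a _; rewrite mulrC. Qed.

Lemma pairingMz n (h x : 'rV[int]_n) k : pairing h (x *~ k) = pairing h x * k.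
Proof. by rewrite raddfMz -mulrzr intz. Qed.

Lemma pairing_delta n a (z : 'rV[int]_n) : pairing (delta_mx 0 a) z = z 0 a.
Proof.
rewrite /pairing (bigD1 a) //= mxE !eqxx mul1r big1 ?addr0 // => b ba.
by rewrite mxE eqxx (negbTE ba) mul0r.
Qed.

Definition form_right y x := form x y.

Lemma form_is_zmod_morphism y : zmod_morphism (form_right y).
Proof.
move=> x x'; rewrite /form_right; have := Defs.formDl (x - x') x' y; rewrite subrK => ->.
by rewrite addrK.
Qed.
HB.instance Definition _ y :=
  GRing.isZmodMorphism.Build _ _ (form_right y) (form_is_zmod_morphism y).

Lemma formBl x x' y : form (x - x') y = form x y - form x' y.
Proof. exact: form_is_zmod_morphism. Qed.
Lemma form0l y : form 0 y = 0.
Proof. exact: (raddf0 (form_right y)). Qed.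
Lemma formNl x y : form (- x) y = - form x y.
Proof. exact: (raddfN (form_right y)). Qed.
Lemma formMzl x y n : form (x *~ n) y = form x y * n%:~R.
Proof. by rewrite mulrzr; exact: (raddfMz (form_right y)). Qed.
Lemma form_suml (J : Type) (s : seq J) (p : pred J) (f : J -> P) y :
  form (\sum_(j <- s | p j) f j) y = \sum_(j <- s | p j) form (f j) y.
Proof. exact: (raddf_sum (form_right y)). Qed.
Lemma formDr x y y' : form x (y + y') = form x y + form x y'.
Proof. by rewrite !(Defs.formC x) Defs.formDl. Qed.
Lemma formBr x y y' : form x (y - y') = form x y - form x y'.
Proof. by rewrite !(Defs.formC x) formBl. Qed.
Lemma formNr x y : form x (- y) = - form x y.
Proof. by rewrite !(Defs.formC x) formNl. Qed.
Lemma formMzr x y n : form x (y *~ n) = form x y * n%:~R.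
Proof. by rewrite !(Defs.formC x) formMzl. Qed.
Lemma form_sumr (J : Type) (s : seq J) (p : pred J) (f : J -> P) y :
  form y (\sum_(j <- s | p j) f j) = \sum_(j <- s | p j) form y (f j).
Proof. by rewrite Defs.formC form_suml; apply: eq_bigr => j _; rewrite Defs.formC. Qed.

Lemma form_alphaE i mu :
  form (alpha rd i) mu = (dd rd i)%:R * (pairing (coalpha rd i) mu)%:~R.
Proof.
rewrite coalphaE form_alpha; have : (dd rd i)%:R != 0 :> rat.
  by rewrite pnatr_eq0 -lt0n dd_gt0.
by move=> d0; field.
Qed.

Lemma pairing_alpha i : pairing (coalpha rd i) (alpha rd i) = 2.
Proof.
apply/eqP; rewrite -(eqr_int rat); apply/eqP.
have d0 : (dd rd i)%:R != 0 :> rat by rewrite pnatr_eq0 -lt0n dd_gt0.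
apply: (mulfI d0); rewrite -form_alphaE form_alpha; ring.
Qed.

Lemma srefE i x : sref i x = x - alpha rd i *~ pairing (coalpha rd i) x.
Proof. by rewrite /sref scalezE. Qed.

Lemma sref_is_zmod_morphism i : zmod_morphism (sref i).
Proof.
move=> x y; rewrite !srefE raddfB /= mulrzBr.
by apply/rowP => a; rewrite !mxE; ring.
Qed.
HB.instance Definition _ i :=
  GRing.isZmodMorphism.Build _ _ (sref i) (sref_is_zmod_morphism i).

Lemma wact_is_zmod_morphism s : zmod_morphism (wact s).
Proof.
elim: s => [|i s IH] x y //=; rewrite /wact /= -!/(wact s _) IH.
exact: raddfB.
Qed.
HB.instance Definition _ s :=
  GRing.isZmodMorphism.Build _ _ (wact s) (wact_is_zmod_morphism s).

Lemma form_sref i x y : form (sref i x) (sref i y) = form x y.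
Proof.
rewrite !srefE formBl !formBr !formMzl !formMzr (Defs.formC x (alpha rd i)).
by rewrite !form_alphaE pairing_alpha; ring.
Qed.

Lemma form_wact s x y : form (wact s x) (wact s y) = form x y.
Proof. by elim: s => //= i s IH; rewrite form_sref. Qed.

Lemma wact_rcons s i x : wact (rcons s i) x = wact s (sref i x).
Proof. by rewrite /wact -cats1 foldr_cat. Qed.

Lemma sref_fix i x : pairing (coalpha rd i) x = 0 -> sref i x = x.
Proof. by move=> E; rewrite srefE E mulr0z subr0. Qed.

Lemma sref_varpi_neq i j : i != j -> sref i (varpi rd j) = varpi rd j.
Proof. by move=> /negbTE ij; rewrite sref_fix // varpiE ij. Qed.

Lemma sref_varpi i : sref i (varpi rd i) = varpi rd i - alpha rd i.
Proof. by rewrite srefE varpiE eqxx. Qed.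

Lemma pairing_cosref i h x : pairing (cosref i h) x = pairing h (sref i x).
Proof.
rewrite srefE raddfB /= pairingMz /cosref scalezE pairingC raddfB /= pairingMz.
by rewrite [pairing x h]pairingC [pairing x _]pairingC mulrC.
Qed.

Lemma cosrefK i h : cosref i (cosref i h) = h.
Proof.
rewrite /cosref !scalezE [pairing (_ - _) _]pairingC raddfB /= pairingMz.
rewrite [pairing _ (coalpha _ _)]pairingC pairing_alpha [pairing h _]pairingC.
set n := pairing _ h; have -> : n - 2 * n = - n by ring.
by rewrite mulrNz opprK subrK.
Qed.

Lemma cosrefN i h : cosref i (- h) = - cosref i h.
Proof.
rewrite /cosref !scalezE [pairing (- h) _]pairingC raddfN /= pairingC mulrNz.
by rewrite opprB opprK addrC.
Qed.

Definition root_lattice x := exists c : 'I_r -> int, x = \sum_i c i *: alpha rd i.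

Lemma root_latticeB x y : root_lattice x -> root_lattice y -> root_lattice (x - y).
Proof.
move=> [c ->] [c' ->]; exists (fun i => c i - c' i).
by rewrite -sumrB; apply: eq_bigr => i _; rewrite scalerBl.
Qed.
Lemma root_lattice0 : root_lattice 0.
Proof. by exists (fun=> 0); rewrite big1 // => i _; rewrite scale0r. Qed.
Lemma root_latticeN x : root_lattice x -> root_lattice (- x).
Proof. by rewrite -sub0r; apply: root_latticeB root_lattice0. Qed.
Lemma root_latticeD x y : root_lattice x -> root_lattice y -> root_lattice (x + y).
Proof. by move=> hx hy; rewrite -[y]opprK; apply/root_latticeB/root_latticeN. Qed.
Lemma root_lattice_alpha i n : root_lattice (alpha rd i *~ n).
Proof.
exists (fun j => if j == i then n else 0); rewrite (bigD1 i) //= eqxx big1 ?addr0 ?scalezE //.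
by move=> j /negbTE ->; rewrite scale0r.
Qed.
Lemma root_lattice_sum (J : Type) (s : seq J) (p : pred J) (f : J -> P) :
  (forall j, root_lattice (f j)) -> root_lattice (\sum_(j <- s | p j) f j).
Proof.
move=> h; elim/big_ind: _ => // [|x y]; [exact: root_lattice0|exact: root_latticeD].
Qed.

Lemma root_lattice_wact s x : root_lattice x -> root_lattice (wact s x).
Proof.
move=> hx; elim: s => //= i s IH; rewrite srefE; apply: root_latticeB => //.
exact: root_lattice_alpha.
Qed.

Lemma root_lattice_int x mu : root_lattice x -> exists n : int, form x mu = n%:~R.
Proof.
move=> [c ->]; exists (\sum_i c i * ((dd rd i)%:Z * pairing (coalpha rd i) mu)).
rewrite form_suml rmorph_sum; apply: eq_bigr => i _ /=.
by rewrite scalezE formMzl form_alphaE !rmorphM /= mulrC.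
Qed.

Lemma root_lattice_even x : root_lattice x -> exists n : int, form x x = (2 * n)%:~R.
Proof.
move=> [c ->].
elim: (index_enum _) => [|i s [n IH]]; first by exists 0; rewrite big_nil form0l mulr0.
rewrite big_cons; set y := \sum_(j <- s) _ in IH *.
exists (n + (dd rd i)%:Z * c i * pairing (coalpha rd i) y + (dd rd i)%:Z * c i * c i).
rewrite Defs.formDl !formDr IH (Defs.formC y) scalezE !formMzl !formMzr form_alpha form_alphaE.
by rewrite !(rmorphD, rmorphM) /=; ring.
Qed.

End Root.

Section Word.
Variables (r l : nat) (iw : l.-tuple 'I_r).
Notation word := (tnth iw).
Notation snext := (snext iw).
Notation ufw := (ufw iw).
Notation kmin := (kmin iw).
Notation kmax := (kmax iw).
Notation kone := (kone iw).
Notation in_interval := (in_interval iw).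
Implicit Types (j k s : 'I_l).

Lemma bigmin_leq (p : pred 'I_l) j : p j -> (\big[minn/l]_(i < l | p i) i <= j)%N.
Proof.
move=> pj; have := mem_index_enum j; elim: (index_enum _) => // i s IH.
rewrite inE big_cons => /orP[/eqP <-|/IH h]; first by rewrite pj geq_minl.
by case: ifP => // _; rewrite geq_min h orbT.
Qed.

Lemma bigmin_witness (p : pred 'I_l) : (\big[minn/l]_(i < l | p i) i < l)%N ->
  exists2 j, p j & \big[minn/l]_(i < l | p i) i = j.
Proof.
have : (\big[minn/l]_(i < l | p i) i == l :> nat) \/
    exists2 j, p j & \big[minn/l]_(i < l | p i) i = j.
  elim/big_ind: _ => [|x y hx hy|i pi]; [by left| |by right; exists i].
  by rewrite /minn; case: ltnP.
by case=> [/eqP ->|//]; rewrite ltnn.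
Qed.

Lemma snext_leq j k : (j < k)%N -> word k = word j -> (snext j <= k)%N.
Proof. by move=> jk /eqP wjk; apply: bigmin_leq; rewrite jk. Qed.

Lemma snextP j : (snext j < l)%N ->
  exists k, [/\ snext j = k, (j < k)%N & word k = word j].
Proof. by move=> /bigmin_witness [k /andP[jk /eqP wk] E]; exists k. Qed.

Lemma snext_le_l j : (snext j <= l)%N.
Proof.
rewrite /Defs.snext; elim/big_ind: _ => // [x y hx hy|i _]; last exact: ltnW.
by rewrite geq_min hx.
Qed.

Lemma snext_gt j : (j < snext j)%N.
Proof.
case: (ltnP (snext j) l) => [/snextP [k [-> //]]|].
by apply: leq_trans.
Qed.

Lemma kminP k : word (kmin k) = word k /\ forall j, word j = word k -> (kmin k <= j)%N.
Proof.
rewrite /Defs.kmin; case: arg_minnP => // i /eqP wi im; split=> // j /eqP; exact: im.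
Qed.

Lemma kmaxP k : word (kmax k) = word k /\ forall j, word j = word k -> (j <= kmax k)%N.
Proof.
rewrite /Defs.kmax; case: arg_maxnP => // i /eqP wi im; split=> // j /eqP; exact: im.
Qed.

Lemma in_interval_kmin k s : in_interval (kmin k) k s = (s <= k)%N && (word s == word k).
Proof.
have [wm km] := kminP k; rewrite /Defs.in_interval wm.
by case: eqP => [/km ->|]; rewrite ?andbT ?andbF.
Qed.

Lemma kmaxK k : k \notin ufw -> kmax k = k.
Proof.
rewrite inE -leqNgt => lk; have [wm km] := kmaxP k.
apply/val_inj/eqP; rewrite /= eqn_leq km // andbT leqNgt.
by apply/negP => /snext_leq /(_ wm); have := ltn_ord (kmax k); lia.
Qed.

Lemma kmax_frozen k : kmax k \notin ufw.
Proof.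
rewrite inE; apply/negP => /snextP [j [_ kj wj]].
have [wm km] := kmaxP k; have := km j; rewrite wj wm => /(_ erefl); lia.
Qed.

Lemma frozen_max k j : k \notin ufw -> word j = word k -> (j <= k)%N.
Proof. by move=> kf; have [_] := kmaxP k; rewrite kmaxK // => km; apply: km. Qed.

Lemma frozen_inj j k : j \notin ufw -> k \notin ufw -> word j = word k -> j = k.
Proof.
move=> jf kf w; apply/val_inj/eqP; rewrite /= eqn_leq.
by rewrite (frozen_max kf) // (frozen_max jf).
Qed.

Lemma kmin_kmax k : kmin (kmax k) = kmin k.
Proof.
have [wm km] := kmaxP k; have [wi ki] := kminP k; have [wi' ki'] := kminP (kmax k).
by apply/val_inj/eqP; rewrite /= eqn_leq ki ?ki' ?wi ?wi'.
Qed.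

Lemma koneP k : k \in ufw -> [/\ (kone k : nat) = snext k, (k < kone k)%N,
  word (kone k) = word k & forall s, (k < s)%N -> word s = word k -> (kone k <= s)%N].
Proof.
rewrite inE => kl; have E : (kone k : nat) = snext k by rewrite /Defs.kone val_insubd kl.
have [j [Ej kj wj]] := snextP kl.
have {}Ej : kone k = j by apply: val_inj; rewrite /= E.
split=> //; rewrite ?Ej // => s ks ws; rewrite -Ej E; exact: snext_leq.
Qed.

Definition last_before (n : nat) j : bool := (j < n <= snext j)%N.

(* In this form the columns of [B(t_0)] telescope along each letter. *)
Lemma bmat_t0 rd j (k : unfrozen ufw) : bmat (t0 rd iw) j k =
  cartan rd (word j) (word (val k))
    * ((last_before (val k).+1 j)%:Z - (last_before (snext (val k)) j)%:Z)
  + (word j == word (val k))%:Z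
    * ((last_before (val k) j)%:Z - (last_before (snext (val k)).+1 j)%:Z).
Proof.
have := valP k; rewrite inE /=; case: k => [k ku] /= kl {ku}.
have [k' [Ek kk' wk']] := snextP kl.
have jn := snext_gt j; have jl := snext_le_l j.
rewrite /last_before.
case: (eqVneq (word j) (word k)) => [w|w].
  have a1 : (j < k)%N -> (snext j <= k)%N by move=> h; apply: snext_leq.
  have a2 : (j < k')%N -> (snext j <= k')%N by move=> h; apply: snext_leq; rewrite ?wk'.
  have a3 : (k < j)%N -> (snext k <= j)%N by move=> h; apply: snext_leq.
  have a4 : (j : nat) = k -> snext j = snext k by move=> /val_inj ->.
  have -> : (j < k.+1 <= snext j)%N = (j == k :> nat) by lia.
  have -> : (j < snext k <= snext j)%N = (j == k :> nat) by lia.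
  rewrite subrr mulr0 add0r mul1r.
  have -> : (j < k <= snext j)%N = (snext j == k) by lia.
  have -> : (j < (snext k).+1 <= snext j)%N = (j == snext k :> nat) by lia.
  have e1 : (j < k < snext j)%N = false by lia.
  have e2 : (k < j < snext k)%N = false by lia.
  rewrite e1 e2 /=; case: eqP => h1; case: eqP => h2 //=; lia.
rewrite mul0r addr0.
have n1 : snext j != k.
  apply: contraNneq w => e; have [|i [Ei _ wi]] := snextP (j := j).
    by rewrite e; apply: ltn_ord.
  by rewrite -wi; apply/eqP; congr word; apply: val_inj; rewrite /= -Ei -e.
have n2 : (j : nat) != snext k.
  by apply: contraNneq w; rewrite Ek => /val_inj ->; rewrite wk'.
have n3 : snext j != snext k.
  apply: contraNneq w => e; have [|i [Ei _ wi]] := snextP (j := j); first by rewrite e.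
  by rewrite -wi -wk'; apply/eqP; congr word; apply: val_inj; rewrite /= -Ei -Ek e.
have n4 : (j : nat) != k by apply: contraNneq w => /val_inj ->.
rewrite (negbTE n1) (negbTE n2).
case: ifP => h1.
  have -> : (j < k.+1 <= snext j)%N = true by lia.
  have -> : (j < snext k <= snext j)%N = false by lia.
  by rewrite subr0 mulr1.
case: ifP => h2.
  have -> : (j < k.+1 <= snext j)%N = false by lia.
  have -> : (j < snext k <= snext j)%N = true by lia.
  by rewrite sub0r mulrN1.
have -> : (j < k.+1 <= snext j)%N = (j < snext k <= snext j)%N by lia.
by rewrite subrr mulr0.
Qed.

Section Roots.
Variable rd : root_datum r.
Notation P := 'rV[int]_(rkP rd).
Notation wact := (@Defs.wact r rd).
Notation beta := (beta rd iw).
Notation betaI := (betaI rd iw).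

Lemma take_iwS k : take k.+1 iw = rcons (take k iw) (word k).
Proof. by rewrite (take_nth (word k)) ?size_tuple ?ltn_ord // -tnth_nth. Qed.

Lemma varpi_telescope i n : (n <= l)%N -> varpi rd i - wact (take n iw) (varpi rd i)
  = \sum_(s < l | (s < n)%N && (word s == i)) beta s.
Proof.
elim: n => [|n IH] nl; first by rewrite take0 subrr big1 // => s; rewrite ltn0.
rewrite -[n]/(val (Ordinal nl)) take_iwS wact_rcons; set k := Ordinal nl.
have E s : (s < n.+1)%N && (word s == i) && (s != k) = (s < n)%N && (word s == i).
  by rewrite -val_eqE /= ltnS andbAC [(s <= n)%N && _]andbC -ltn_neqAle.
case: (eqVneq (word k) i) => [wk|wk].
  rewrite (bigD1 k) /=; last by rewrite ltnSn wk eqxx.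
  rewrite (eq_bigl _ _ E) -IH ?(ltnW nl) // wk sref_varpi raddfB /= /Defs.beta wk.
  by rewrite opprB addrC -addrA [RHS]addrC; apply/rowP => a; rewrite !mxE; ring.
rewrite sref_varpi_neq // IH ?(ltnW nl) //; apply: eq_bigl => s.
rewrite -E; case: (eqVneq s k) => [->|_]; rewrite ?andbT //.
by rewrite (negbTE wk) andbF.
Qed.

Lemma betaI_kminE k : betaI (kmin k) k
  = varpi rd (word k) - wact (take k.+1 iw) (varpi rd (word k)).
Proof.
rewrite varpi_telescope ?ltn_ord //; apply: eq_bigl => s.
by rewrite in_interval_kmin.
Qed.

Lemma betaI_frozen k : k \notin ufw -> betaI (kmin k) k
  = varpi rd (word k) - wact iw (varpi rd (word k)).
Proof.
move=> kf; rewrite -[X in wact X](@take_oversize _ l) ?size_tuple //.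
rewrite varpi_telescope //; apply: eq_bigl => s; rewrite in_interval_kmin ltn_ord.
by case: eqP => [/(frozen_max kf) -> |]; rewrite ?andbF.
Qed.

Lemma betaI_split k : k \in ufw ->
  betaI (kmin (kmax k)) (kmax k) = betaI (kmin k) k + betaI (kone k) (kmax k).
Proof.
move=> ku; have [_ ks w1 kn] := koneP ku; have [wm km] := kmaxP k.
rewrite /Defs.betaI (bigID (fun s : 'I_l => (s <= k)%N)) /=; congr (_ + _);
    apply: eq_bigl => s; rewrite !in_interval_kmin ?/(Defs.in_interval _ _ _ _) ?wm ?w1.
  by case: (eqVneq (word s) (word k)) => [/km ->|]; rewrite ?andbT ?andbF.
case: (eqVneq (word s) (word k)) => [w|]; rewrite ?andbF //= !andbT km // andbT -ltnNge.
by apply/idP/idP => [sk|]; [exact: kn|exact: leq_trans].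
Qed.

Lemma root_lattice_beta k : root_lattice (beta k).
Proof.
by apply: root_lattice_wact; rewrite -[alpha _ _]mulr1z; apply: root_lattice_alpha.
Qed.

Lemma root_lattice_betaI j k : root_lattice (betaI j k).
Proof. by apply: root_lattice_sum => s; apply: root_lattice_beta. Qed.

Lemma sum_last_before i n : (n <= l)%N ->
  \sum_(j | word j == i) betaI (kmin j) j *~ (last_before n j)%:Z
  = varpi rd i - wact (take n iw) (varpi rd i).
Proof.
move=> nl; rewrite varpi_telescope //.
case: (pickP (fun s : 'I_l => (s < n)%N && (word s == i))) => [s0 s0P|none].
  have [s /andP[sn /eqP ws] smax] :=
    @arg_maxnP _ s0 (fun s : 'I_l => (s < n)%N && (word s == i)) val s0P.
  have ns : (n <= snext s)%N.
    rewrite leqNgt; apply/negP => h; have [|s' [E ss' w']] := snextP (j := s).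
      exact: leq_trans nl.
    have := smax s'; rewrite -E h w' ws eqxx => /(_ isT); have /= := snext_gt s; lia.
  rewrite (bigD1 s) ?ws //= /last_before sn ns mulr1z big1 ?addr0 => [|j /andP[/eqP wj js]].
    apply: eq_bigl => j; rewrite in_interval_kmin ws.
    case: (eqVneq (word j) i) => [wj|]; rewrite ?andbF // !andbT.
    by apply/idP/idP => [h|h]; [exact: leq_ltn_trans sn|apply: smax; rewrite h wj eqxx].
  case: andP => [[jn nj]|//]; have := smax j; rewrite jn wj eqxx => /(_ isT) /= h.
  have : (j < s)%N by rewrite ltn_neqAle h andbT.
  by move=> /snext_leq; rewrite ws wj => /(_ erefl); lia.
rewrite big1 => [|j /eqP wj]; last first.
  by have := none j; rewrite wj eqxx andbT /last_before => ->.
by rewrite big1 // => s; rewrite none.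
Qed.

Lemma wact_fix (u : seq 'I_r) (z : P) :
  (forall i, pairing (coalpha rd i) z = 0) -> wact u z = z.
Proof. by move=> h; elim: u => //= i u ->; apply: sref_fix. Qed.

Lemma t0_balanced (k : unfrozen ufw) :
  \sum_j betaI (kmin j) j *~ bmat (t0 rd iw) j k = 0.
Proof.
have ku := valP k; have [E kk1 w1 _] := koneP ku.
set k1 := kone (val k) in E kk1 w1; set ik := word (val k) in w1.
have S n : (n <= l)%N -> forall i,
    \sum_(j | word j == i) betaI (kmin j) j *~ (last_before n j)%:Z
  = varpi rd i - wact (take n iw) (varpi rd i) by move=> nl i; apply: sum_last_before.
pose u := wact (take (val k).+1 iw); pose u' := wact (take k1 iw).
have E1 : \sum_j betaI (kmin j) j *~ (cartan rd (word j) ik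
    * ((last_before (val k).+1 j)%:Z - (last_before k1 j)%:Z))
    = \sum_i (u' (varpi rd i) - u (varpi rd i)) *~ cartan rd i ik.
  rewrite (partition_big word xpredT) //=; apply: eq_bigr => i _.
  rewrite (eq_bigr (fun j => (betaI (kmin j) j *~ (last_before (val k).+1 j)%:Z
      - betaI (kmin j) j *~ (last_before k1 j)%:Z) *~ cartan rd i ik)); last first.
    by move=> j /eqP ->; rewrite mulrC mulrzA mulrzBr.
  rewrite -mulrz_suml sumrB !S ?ltn_ord ?(ltnW (ltn_ord _)) //.
  by congr (_ *~ _); apply/rowP => a; rewrite !mxE; ring.
have E2 : \sum_j betaI (kmin j) j *~ ((word j == ik)%:Z
    * ((last_before (val k) j)%:Z - (last_before k1.+1 j)%:Z))
    = u' (varpi rd ik - alpha rd ik) - u (varpi rd ik - alpha rd ik).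
  rewrite (bigID (fun j => word j == ik)) /= [X in _ + X]big1 ?addr0; last first.
    by move=> j /negbTE ->; rewrite mul0r.
  rewrite (eq_bigr (fun j => betaI (kmin j) j *~ (last_before (val k) j)%:Z
      - betaI (kmin j) j *~ (last_before k1.+1 j)%:Z)); last first.
    by move=> j ->; rewrite mul1r mulrzBr.
  rewrite sumrB !S ?ltn_ord ?(ltnW (ltn_ord _)) // take_iwS w1 wact_rcons -/u' sref_varpi.
  rewrite /u take_iwS wact_rcons -/ik [Defs.sref ik _]raddfB /= sref_varpi srefE pairing_alpha.
  by rewrite !raddfB /= raddfMz /=; apply/rowP => a; rewrite !mxE; ring.
under eq_bigr do rewrite bmat_t0 -E mulrzDr.
rewrite big_split /= E1 E2.
pose z := alpha rd ik - \sum_i varpi rd i *~ cartan rd i ik.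
have zfix (a : seq 'I_r) : wact a z = z.
  apply: wact_fix => i; rewrite /z raddfB [X in _ - X]raddf_sum [X in _ - X](bigD1 i) //=.
  rewrite [X in _ - (_ + X)]big1 ?addr0.
    by rewrite pairingMz varpiE eqxx mul1r subrr.
  by move=> j ji; rewrite pairingMz varpiE eq_sym (negbTE ji) mul0r.
have Eu (a : seq 'I_r) :
    \sum_i wact a (varpi rd i) *~ cartan rd i ik = wact a (alpha rd ik) - z.
  rewrite -[in RHS](zfix a) -raddfB /z opprB addrCA subrr addr0 raddf_sum.
  by apply: eq_bigr => i _; rewrite raddfMz.
have -> : \sum_i (u' (varpi rd i) - u (varpi rd i)) *~ cartan rd i ik
    = u' (alpha rd ik) - u (alpha rd ik).
  under eq_bigr do rewrite mulrzBl.
  by rewrite sumrB !Eu; apply/rowP => a; rewrite !mxE; ring.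
suff Ev : u' (varpi rd ik) = u (varpi rd ik).
  by move: Ev; rewrite /u /u' !raddfB /= => ->; apply/rowP => a; rewrite !mxE; ring.
apply/eqP; rewrite -subr_eq0 -(subrKA (varpi rd ik)) addrC -opprB; apply/eqP.
rewrite !varpi_telescope ?ltn_ord ?(ltnW (ltn_ord _)) //.
apply/eqP; rewrite subr_eq0; apply/eqP; apply: eq_bigl => s.
case: eqP => [w|]; rewrite ?andbF // !andbT.
have := snext_leq (j := val k) (k := s); rewrite w => /(_ _ erefl); move: E kk1 => /=; lia.
Qed.

End Roots.
End Word.

(** * Commutation exponents *)

Section Commutation.
Variables (r l : nat) (iw : l.-tuple 'I_r) (rd : root_datum r).
Notation word := (tnth iw).
Notation ufw := (ufw iw).
Notation kmin := (kmin iw).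
Notation kmax := (kmax iw).
Notation kone := (kone iw).
Notation in_interval := (in_interval iw).
Notation P := 'rV[int]_(rkP rd).
Notation form := (@Defs.form r rd).
Notation wact := (@Defs.wact r rd).
Notation beta := (beta rd iw).
Notation betaI := (betaI rd iw).
Notation cI := (cI iw).
Notation Nform := (Nform rd iw).
Implicit Types (j k s : 'I_l).

Definition order_sign (a b : 'I_l) : rat := (b < a)%N%:R - (a < b)%N%:R.

Lemma NformE c c' : Nform c c' = \sum_(a < l) \sum_(b < l)
  order_sign a b * form (beta a) (beta b) * (c a)%:R * (c' b)%:R.
Proof.
rewrite /Defs.Nform -sumrB; apply: eq_bigr => a _.
rewrite big_mkcond [X in _ - X]big_mkcond -sumrB; apply: eq_bigr => b _.
by rewrite /order_sign; case: ltngtP => _ /=; ring.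
Qed.

Lemma Nform_int c c' : Nform c c' \is a Num.int.
Proof.
rewrite NformE; apply: rpred_sum => a _; apply: rpred_sum => b _.
have [n ->] := root_lattice_int (beta b) (root_lattice_beta iw rd a).
by rewrite /order_sign !(rpredM, rpredB) // ?intr_int ?natr_int ?Num.Theory.natr_int.
Qed.

Lemma Lam_t0E j k :
  (Lam (t0 rd iw) j k)%:~R = Nform (cI (kmin j) j) (cI (kmin k) k).
Proof. by rewrite /=; apply/floorK/Nform_int. Qed.

Lemma NformC c c' : Nform c c' = - Nform c' c.
Proof.
rewrite !NformE exchange_big /= -sumrN; apply: eq_bigr => a _.
rewrite -sumrN; apply: eq_bigr => b _.
by rewrite Defs.formC /order_sign; ring.
Qed.

Lemma Lam_t0_kmax k : k \in ufw -> (Lam (t0 rd iw) (kmax k) k)%:~R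
  = form (betaI (kone k) (kmax k)) (betaI (kmin k) k).
Proof.
move=> ku; rewrite Lam_t0E kmin_kmax; have [_ ks w1 kn] := koneP ku.
have [wm km] := kmaxP iw k; have [wi _] := kminP iw k.
have cE a : cI (kmin k) (kmax k) a = (cI (kmin k) k a + cI (kone k) (kmax k) a)%N.
  rewrite !ffunE -{1}kmin_kmax !in_interval_kmin /Defs.in_interval wm w1.
  case: (eqVneq (word a) (word k)) => [w|]; rewrite ?andbF // !andbT km // andbT.
  have := kn a; rewrite w => /(_ _ erefl) h.
  by case: (leqP a k) h => [ak _|ak -> //]; rewrite leqNgt (leq_ltn_trans ak ks).
have -> : Nform (cI (kmin k) (kmax k)) (cI (kmin k) k)
    = Nform (cI (kmin k) k) (cI (kmin k) k) + Nform (cI (kone k) (kmax k)) (cI (kmin k) k).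
  rewrite !NformE -big_split; apply: eq_bigr => a _ /=; rewrite -big_split.
  by apply: eq_bigr => b _ /=; rewrite cE natrD; ring.
have -> : Nform (cI (kmin k) k) (cI (kmin k) k) = 0.
  by have := NformC (cI (kmin k) k) (cI (kmin k) k); lra.
rewrite add0r NformE /Defs.betaI form_suml [RHS]big_mkcond; apply: eq_bigr => a _.
rewrite form_sumr; case: ifP => ha; last first.
  by apply: big1 => b _; rewrite !ffunE ha mulr0 mul0r.
rewrite [RHS]big_mkcond; apply: eq_bigr => b _; rewrite !ffunE ha mulr1.
case: ifP => hb; last by rewrite mulr0.
rewrite mulr1 /order_sign; move: ha hb.
rewrite in_interval_kmin => /andP[/andP[ka _] _] /andP[bk _].
have ba : (b < a)%N by apply: leq_ltn_trans bk (leq_trans ks ka).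
by rewrite ba ltnNge (ltnW ba) subr0 mul1r.
Qed.

Lemma form_betaI_self k : form (betaI (kmin k) k) (betaI (kmin k) k)
  = 2%:R * form (varpi rd (word k)) (betaI (kmin k) k).
Proof.
rewrite betaI_kminE !formBr !formBl form_wact (Defs.formC (wact _ _) (varpi _ _)).
by ring.
Qed.

Lemma Nform_frozen j b : j \notin ufw ->
  \sum_(a < l) order_sign a b * form (beta a) (beta b) * (cI (kmin j) j a)%:R
  = - form (varpi rd (word j) + wact iw (varpi rd (word j))) (beta b).
Proof.
move=> jf; set w := word j; set vp := varpi rd w.
have cE a : cI (kmin j) j a = (word a == w) :> nat.
  rewrite ffunE in_interval_kmin -/w; case: eqP => [/(frozen_max jf) ->|] //.
  by rewrite andbF.
pose low := \sum_(s < l | (s < b)%N && (word s == w)) beta s.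
pose mid := \sum_(s < l | (s < b.+1)%N && (word s == w)) beta s.
pose all := \sum_(s < l | (s < l)%N && (word s == w)) beta s.
have -> : \sum_(a < l) order_sign a b * form (beta a) (beta b) * (cI (kmin j) j a)%:R
    = form all (beta b) - form mid (beta b) - form low (beta b).
  rewrite /all /mid /low !form_suml [X in _ = X - _ - _]big_mkcond.
  rewrite [X in _ = _ - X - _]big_mkcond [X in _ = _ - X]big_mkcond -!sumrB.
  apply: eq_bigr => a _.
  rewrite cE ltn_ord /order_sign ltnS; case: (word a == w); rewrite ?andbF ?subrr ?mulr0 //=.
  by rewrite !andbT; case: ltngtP => _ /=; ring.
rewrite /all /mid /low -!varpi_telescope ?(ltnW (ltn_ord _)) // -/vp.
rewrite take_oversize ?size_tuple // take_iwS wact_rcons srefE raddfB raddfMz /=.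
have E : form (wact (take b iw) vp) (beta b) = form (alpha rd (word b)) vp.
  by rewrite form_wact Defs.formC.
have E' : form (wact (take b iw) (alpha rd (word b))) (beta b) = 2%:R * (dd rd (word b))%:R.
  by rewrite form_wact form_alpha.
rewrite !(formBl, Defs.formDl) formMzl E E' form_alphaE.
by ring.
Qed.

(* Central frozen monomials of weight zero are trivial: with [vp = sum_j p_j varpi_j],
   weight zero means [w vp = vp], and centrality that [vp + w vp] is orthogonal to
   every root [beta_b]; together these make [vp] orthogonal to every [alpha_(i_b)]. *)
Lemma frozen_kernel (p : {ffun 'I_l -> int}) :
  (forall j, j \in ufw -> p j = 0) ->
  (forall k, lam (t0 rd iw) p (fvec k) = 0) ->
  \sum_j betaI (kmin j) j *~ p j = 0 -> p = 0.
Proof.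
move=> pf pl pw; pose vp := \sum_j varpi rd (word j) *~ p j.
have pfj (G H : 'I_l -> P) : (forall j, j \notin ufw -> G j = H j) ->
    \sum_j G j *~ p j = \sum_j H j *~ p j.
  move=> GH; apply: eq_bigr => j _.
  by case: (boolP (j \in ufw)) => ju; rewrite ?(pf j ju) ?mulr0z // GH.
have wvp : wact iw vp = vp.
  apply/eqP; rewrite eq_sym -subr_eq0; apply/eqP; rewrite -[RHS]pw.
  rewrite (pfj _ _ (fun j h => betaI_frozen rd h)) /= /vp raddf_sum -sumrB.
  by apply: eq_bigr => j _; rewrite raddfMz mulrzBl.
pose G b := \sum_j (p j)%:~R * \sum_(a < l)
    order_sign a b * form (beta a) (beta b) * (cI (kmin j) j a)%:R.
have sumG k : \sum_(b | in_interval (kmin k) k b) G b = 0.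
  have := pl k => /(congr1 (fun z : int => z%:~R : rat)) /=.
  rewrite lamE {1}/linext rmorph_sum /= => E; rewrite -[RHS]E.
  rewrite exchange_big; apply: eq_bigr => j _ /=.
  rewrite linext_fvec mulrzz rmorphM /= floorK ?Nform_int // NformE -mulr_sumr mulrC.
  congr (_ * _); rewrite [RHS]exchange_big big_mkcond; apply: eq_bigr => b _ /=.
  rewrite -mulr_suml [cI (kmin k) k b]ffunE; case: ifP => hb; by rewrite ?hb ?mulr1 ?mulr0.
have G0 b : G b = 0.
  have [n] := ubnP (b : nat); elim: n b => // n IH b bn.
  have := sumG b; rewrite (bigD1 b) /=; last by rewrite in_interval_kmin leqnn eqxx.
  rewrite big1 ?addr0 // => s; rewrite in_interval_kmin => /andP[/andP[sb _] ne].
  apply: IH; have : (s < b)%N by rewrite ltn_neqAle ne.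
  by move: bn; lia.
have orth b : form vp (beta b) = 0.
  have : G b = - (2%:R * form vp (beta b)).
    have -> : 2%:R * form vp (beta b) = form (vp + wact iw vp) (beta b).
      by rewrite wvp Defs.formDl; ring.
    rewrite /vp raddf_sum -big_split /= form_suml -sumrN; apply: eq_bigr => j _.
    case: (boolP (j \in ufw)) => ju.
      by rewrite (pf j ju) mul0r !mulr0z raddf0 addr0 form0l oppr0.
    by rewrite Nform_frozen // raddfMz -mulrzDl formMzl mulrN mulrC.
  by rewrite G0; lra.
have fix_prefix n : (n <= l)%N -> wact (take n iw) vp = vp /\
    forall b : 'I_l, (b < n)%N -> pairing (coalpha rd (word b)) vp = 0.
  elim: n => [|n IH] nl; first by rewrite take0.
  have [Ev Ep] := IH (ltnW nl); pose b := Ordinal nl.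
  have pb : pairing (coalpha rd (word b)) vp = 0.
    have := orth b; rewrite -{1}Ev form_wact Defs.formC form_alphaE => /eqP.
    by rewrite mulf_eq0 pnatr_eq0 intr_eq0 eqn0Ngt dd_gt0 => /eqP.
  split; first by rewrite -[n]/(val b) take_iwS wact_rcons sref_fix.
  move=> b' ; rewrite ltnS leq_eqVlt => /orP[/eqP E|]; last exact: Ep.
  by rewrite (_ : b' = b) //; apply: val_inj.
apply/ffunP => j; rewrite [RHS]ffunE; case: (boolP (j \in ufw)) => [/pf //|jf].
have [_ /(_ j (ltn_ord j))] := fix_prefix l (leqnn l).
rewrite /vp raddf_sum (bigD1 j) //= big1 ?addr0; first by rewrite pairingMz varpiE eqxx mul1r.
move=> i ij; rewrite pairingMz varpiE.
case: (boolP (i \in ufw)) => [/pf ->|iuf]; first by rewrite mulr0.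
by case: eqP => [/esym /(frozen_inj iuf jf) /eqP|_]; rewrite ?(negbTE ij) ?mul0r.
Qed.

End Commutation.

(** * Weights in the quantized enveloping algebra *)

Definition qvC (a : rat) : Qv := tofrac a%:P.

Lemma qvC_is_zmod_morphism : zmod_morphism qvC.
Proof. by move=> a b; rewrite /qvC polyCB tofracB. Qed.
Lemma qvC_is_monoid_morphism : monoid_morphism qvC.
Proof. by split=> [|a b]; rewrite /qvC ?polyC1 ?tofrac1 // polyCM tofracM. Qed.
HB.instance Definition _ := GRing.isZmodMorphism.Build _ _ qvC qvC_is_zmod_morphism.
HB.instance Definition _ := GRing.isMonoidMorphism.Build _ _ qvC qvC_is_monoid_morphism.

Definition barp (p : {poly rat}) : Qv := (map_poly qvC p).[v^-1].

Lemma barp_rev (p : {poly rat}) n : (size p <= n)%N ->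
  v ^+ n * barp p = tofrac (\sum_(i < n) p`_i *: 'X^(n - i)).
Proof.
move=> pn; rewrite /barp (@horner_coef_wide _ n) ?(leq_trans (size_poly _ _)) //.
rewrite mulr_sumr rmorph_sum; apply: eq_bigr => i _ /=.
rewrite coef_map /= -mul_polyC tofracM tofracXn -/v mulrCA; congr (_ * _).
by rewrite exprVn -{1}(subnK (ltnW (ltn_ord i))) exprD mulfK // expf_neq0 // v_neq0.
Qed.

Lemma coef_rev (p : {poly rat}) n j : (j < n)%N ->
  (\sum_(i < n) p`_i *: 'X^(n - i))`_(n - j) = p`_j.
Proof.
move=> jn; rewrite coef_sum (bigD1 (Ordinal jn)) //= coefZ coefXn eqxx mulr1.
rewrite big1 ?addr0 // => i ij; rewrite coefZ coefXn.
have -> : (n - j == n - i)%N = false; last by rewrite mulr0.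
by apply/negbTE; apply: contraNneq ij => E; apply/eqP/val_inj => /=; have := ltn_ord i; lia.
Qed.

Lemma barp_neq0 (p : {poly rat}) : p != 0 -> barp p != 0.
Proof.
apply: contraNneq => E; have := barp_rev (leqnn (size p)); rewrite E mulr0.
move=> /esym/eqP; rewrite tofrac_eq0 => /eqP S; apply/eqP/polyP => j; rewrite coef0.
case: (ltnP j (size p)) => [js|]; last exact: nth_default.
by rewrite -(coef_rev p js) S coef0.
Qed.

Lemma barp_fix (p : {poly rat}) : p`_0 = 0 -> tofrac p = barp p -> p = 0.
Proof.
move=> p0 E; have := barp_rev (leqnn (size p)).
rewrite -E -tofracXn -tofracM => /eqP; rewrite tofrac_eq => /eqP S.
apply/polyP => j; rewrite coef0; case: j => // j.
have := congr1 (fun s : {poly rat} => s`_(size p + j.+1)) S.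
rewrite coefXnM ltnNge leq_addr /= addKn => ->.
rewrite coef_sum big1 // => i _; rewrite coefZ coefXn.
by rewrite (_ : (_ == _) = false) ?mulr0 //; lia.
Qed.

Lemma Qv_fraction (c : Qv) :
  exists p d : {poly rat}, d != 0 /\ c = tofrac p / tofrac d.
Proof.
elim/quotW: c => x; exists \n_x, \d_x; split; first exact: denom_ratioP.
apply: (canRL (mulfK _)); first by rewrite tofrac_eq0 denom_ratioP.
change (FracField.mul (\pi_Qv x)%qT (tofrac \d_x) = tofrac \n_x).
rewrite !piE; apply/eqmodP; rewrite /= FracField.equivfE /FracField.mulf.
by rewrite !numden_Ratio ?mulr1 ?oner_eq0 ?denom_ratioP // mulrC.
Qed.

Section Weights.
Variables (r : nat) (rd : root_datum r) (U : quantized_enveloping rd).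
Notation P := 'rV[int]_(rkP rd).
Notation sref := (@Defs.sref r rd).
Notation Kg := (Kg U).
Notation Fg := (Fg U).
Notation homog := (@homog r rd U).
Notation Uminus := (@Uminus r rd U).
Implicit Types (mu nu h : P) (x y z : U).

Lemma KgM h h' : Kg h * Kg h' = Kg (h + h').
Proof. by case: (Uq_rel U) => [[_ ->]]. Qed.
Lemma Kg0 : Kg 0 = 1.
Proof. by case: (Uq_rel U) => [[-> _]]. Qed.
Lemma KgNK h : Kg (- h) * Kg h = 1.
Proof. by rewrite KgM addNr Kg0. Qed.
Lemma KgKN h : Kg h * Kg (- h) = 1.
Proof. by rewrite KgM subrr Kg0. Qed.

Definition keigen mu x := forall h, Kg h * x * Kg (- h) = q ^ pairing h mu *: x.

Lemma keigen0 mu : keigen mu 0.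
Proof. by move=> h; rewrite mulr0 mul0r scaler0. Qed.
Lemma keigenD mu x y : keigen mu x -> keigen mu y -> keigen mu (x + y).
Proof. by move=> hx hy h; rewrite mulrDr mulrDl hx hy scalerDr. Qed.
Lemma keigenZ c mu x : keigen mu x -> keigen mu (c *: x).
Proof. by move=> hx h; rewrite -scalerAr -scalerAl hx !scalerA mulrC. Qed.
Lemma keigenN mu x : keigen mu x -> keigen mu (- x).
Proof. by rewrite -scaleN1r; apply: keigenZ. Qed.
Lemma keigen1 : keigen 0 1.
Proof. by move=> h; rewrite mulr1 KgKN raddf0 expr0z scale1r. Qed.
Lemma keigenM mu nu x y : keigen mu x -> keigen nu y -> keigen (mu + nu) (x * y).
Proof.
move=> hx hy h; have -> : Kg h * (x * y) * Kg (- h)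
    = (Kg h * x * Kg (- h)) * (Kg h * y * Kg (- h)).
  by rewrite !mulrA -[_ * Kg (- h) * Kg h]mulrA KgNK mulr1.
rewrite hx hy -scalerAl -scalerAr scalerA raddfD /= expfzDr ?q_neq0 //.
Qed.
Lemma keigen_Fg i : keigen (- alpha rd i) (Fg i).
Proof. by move=> h; case: (Uq_rel U) => _ _ -> _ _; rewrite raddfN. Qed.
Lemma keigenX mu x n : keigen mu x -> keigen (mu *~ n%:Z) (x ^+ n).
Proof.
move=> hx; elim: n => [|n IH]; first by rewrite mulr0z; apply: keigen1.
by rewrite exprS intS mulrzDr mulr1z; apply: keigenM.
Qed.

Lemma keigen_braid (T : 'I_r -> U -> U) i mu x : is_braid_inv T ->
  keigen mu x -> keigen (sref i mu) (T i x).
Proof.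
move=> /(_ i) [[Tl [T1 TM] _] TK _ _ _] hx h.
have TZ c z : T i (c *: z) = c *: T i z.
  have T0 : T i 0 = 0.
    have := Tl 1 0 0; rewrite !scale1r addr0 => /(congr1 (fun u => u - T i 0)).
    by rewrite addrK subrr.
  by have := Tl c z 0; rewrite !addr0 T0 addr0.
have TK' h' : Kg h' = T i (Kg (cosref i h')) by rewrite TK cosrefK.
rewrite [Kg h]TK' [Kg (- h)]TK' cosrefN -!TM hx TZ.
by rewrite pairing_cosref.
Qed.

Lemma homogM mu nu x y : homog mu x -> homog nu y -> homog (mu + nu) (x * y).
Proof.
move=> hx hy; elim: hx => [|i m z _ IH|m z z' _ IH _ IH'|c m z _ IH].
- by rewrite add0r mul1r.
- by rewrite addrAC -mulrA; apply: homog_F.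
- by rewrite mulrDl; apply: homog_add.
- by rewrite -scalerAl; apply: homog_scale.
Qed.

Lemma homog_Fg i : homog (- alpha rd i) (Fg i).
Proof. by rewrite -[Fg i]mulr1 -sub0r; apply/homog_F/homog_one. Qed.

Lemma homog_keigen mu x : homog mu x -> keigen mu x.
Proof.
elim=> [|i m z _ IH|m z z' _ IH _ IH'|c m z _ IH].
- exact: keigen1.
- by rewrite addrC; apply: keigenM => //; apply: keigen_Fg.
- exact: keigenD.
- exact: keigenZ.
Qed.

Lemma homog_Uminus mu x : homog mu x -> Uminus x.
Proof.
elim=> [|i m z _ IH|m z z' _ IH _ IH'|c m z _ IH].
- by rewrite -[1]scale1r; apply: gen_scal.
- by apply: gen_mul => //; apply: gen_mem; exists i.
- exact: gen_add.
- by rewrite -[z]mul1r scalerAl; apply: gen_mul => //; apply: gen_scal.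
Qed.

Lemma homog_root_lattice mu x : homog mu x -> root_lattice mu.
Proof.
elim=> // [|i m z _ IH]; first exact: root_lattice0.
by apply: root_latticeB => //; rewrite -[alpha _ _]mulr1z; apply: root_lattice_alpha.
Qed.

Lemma Uminus0 : Uminus 0.
Proof. by rewrite -(scale0r 1); apply: gen_scal. Qed.
Lemma UminusZ c x : Uminus x -> Uminus (c *: x).
Proof. by move=> h; rewrite -[x]mul1r scalerAl; apply: gen_mul => //; apply: gen_scal. Qed.

Definition khomog mu x := Uminus x /\ keigen mu x.

Definition wsum (p : pred P) x := exists s : seq (P * U),
  (forall e, e \in s -> khomog e.1 e.2 /\ p e.1) /\ x = \sum_(e <- s) e.2.

Lemma wsum_ind (p : pred P) (Q : U -> Prop) : Q 0 ->
  (forall mu x y, khomog mu x -> p mu -> wsum p y -> Q y -> Q (x + y)) ->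
  forall x, wsum p x -> Q x.
Proof.
move=> Q0 QD x [s [sP ->]]; elim: s sP => [|[mu y] s IH] sP; first by rewrite big_nil.
have [hy pm] := sP _ (mem_head _ _).
have sP' e : e \in s -> khomog e.1 e.2 /\ p e.1.
  by move=> es; apply: sP; rewrite inE es orbT.
by rewrite big_cons; apply: (QD mu) => //; [exists s|apply: IH].
Qed.

Lemma wsum0 p : wsum p 0.
Proof. by exists [::]; rewrite big_nil. Qed.
Lemma wsumD p x y : wsum p x -> wsum p y -> wsum p (x + y).
Proof.
move=> [s [sP ->]] [s' [sP' ->]]; exists (s ++ s'); rewrite big_cat; split=> // e.
by rewrite mem_cat => /orP[/sP|/sP'].
Qed.
Lemma wsum_khomog (p : pred P) mu x : khomog mu x -> p mu -> wsum p x.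
Proof.
by move=> hx pm; exists [:: (mu, x)]; rewrite big_seq1; split=> // e; rewrite inE => /eqP ->.
Qed.
Lemma khomogZ c mu x : khomog mu x -> khomog mu (c *: x).
Proof. by move=> [h h']; split; [apply: UminusZ|apply: keigenZ]. Qed.
Lemma khomogN mu x : khomog mu x -> khomog mu (- x).
Proof. by rewrite -scaleN1r; apply: khomogZ. Qed.
Lemma khomogD mu x y : khomog mu x -> khomog mu y -> khomog mu (x + y).
Proof. by move=> [h1 h2] [h3 h4]; split; [apply: gen_add|apply: keigenD]. Qed.
Lemma khomogM mu nu x y : khomog mu x -> khomog nu y -> khomog (mu + nu) (x * y).
Proof. by move=> [h1 h2] [h3 h4]; split; [apply: gen_mul|apply: keigenM]. Qed.
Lemma khomog0 mu : khomog mu 0.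
Proof. by split; [apply: Uminus0|apply: keigen0]. Qed.
Lemma khomog1 : khomog 0 1.
Proof. by split; [rewrite -[1]scale1r; apply: gen_scal|apply: keigen1]. Qed.
Lemma homog_khomog mu x : homog mu x -> khomog mu x.
Proof. by move=> h; split; [apply: homog_Uminus h|apply: homog_keigen]. Qed.

Lemma wsumZ p c x : wsum p x -> wsum p (c *: x).
Proof.
move: x; apply: wsum_ind => [|mu x y hx pm _ IH]; first by rewrite scaler0; apply: wsum0.
by rewrite scalerDr; apply: wsumD => //; apply: wsum_khomog pm; apply: khomogZ.
Qed.
Lemma wsumN p x : wsum p x -> wsum p (- x).
Proof. by rewrite -scaleN1r; apply: wsumZ. Qed.
Lemma wsum_Uminus p x : wsum p x -> Uminus x.
Proof.
move: x; apply: wsum_ind => [|mu x y [hx _] _ _ IH]; first exact: Uminus0.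
exact: gen_add.
Qed.

Lemma Uminus_homog_ind (Q : U -> Prop) : Q 0 ->
  (forall mu x y, homog mu x -> Uminus y -> Q y -> Q (x + y)) ->
  forall x, Uminus x -> Q x.
Proof.
move=> Q0 QD x ux.
suff [s [sP ->]] : exists s : seq (P * U),
    (forall e, e \in s -> homog e.1 e.2) /\ x = \sum_(e <- s) e.2.
  elim: s sP => [|[mu y] s IH] sP; first by rewrite big_nil.
  have sP' e : e \in s -> homog e.1 e.2 by move=> es; apply: sP; rewrite inE es orbT.
  rewrite big_cons; apply: (QD mu); [exact: (sP _ (mem_head _ _))| |exact: IH].
  rewrite big_seq; elim/big_ind: _ => [||e /sP' /homog_Uminus //].
    exact: Uminus0.
  exact: gen_add.
elim: ux => {x} [x [i ->]|c _|x y _ [s [sP ->]] _ [s' [sP' ->]]|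
    x y _ [s [sP ->]] _ [s' [sP' ->]]].
- exists [:: (- alpha rd i, Fg i)]; rewrite big_seq1; split=> // e.
  by rewrite inE => /eqP ->; apply: homog_Fg.
- exists [:: (0, c *: 1)]; rewrite big_seq1; split=> // e.
  by rewrite inE => /eqP -> /=; apply/homog_scale/homog_one.
- exists (s ++ s'); rewrite big_cat; split=> // e.
  by rewrite mem_cat => /orP[/sP|/sP'].
exists [seq (e.1 + e'.1, e.2 * e'.2) | e <- s, e' <- s']; split.
  by move=> _ /allpairsP [[e e'] /= [es es' ->]] /=; apply: homogM; [apply: sP|apply: sP'].
by rewrite big_allpairs_dep mulr_suml; apply: eq_bigr => e _; rewrite mulr_sumr.
Qed.

Lemma keigen_indep (s : seq (P * U)) mu x : keigen mu x ->
  (forall e, e \in s -> keigen e.1 e.2 /\ e.1 != mu) ->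
  x + \sum_(e <- s) e.2 = 0 -> x = 0.
Proof.
have [n] := ubnP (size s); elim: n s x => // n IH [|[nu y0] s] x sn hx sP.
  by rewrite big_nil addr0.
have [/= hy nm] := sP _ (mem_head _ _).
have [a na] : exists a, nu 0 a != mu 0 a.
  apply/existsP; apply: contraNT nm; rewrite negb_exists => /forallP E.
  by apply/eqP/rowP => a; have := E a; rewrite negbK => /eqP.
pose h : P := delta_mx 0 a.
pose d (k : P) := q ^ k 0 a - q ^ nu 0 a.
have dE k z : keigen k z -> Kg h * z * Kg (- h) - q ^ nu 0 a *: z = d k *: z.
  by move=> hz; rewrite hz pairing_delta -scalerBl.
rewrite big_cons => /(congr1 (fun z => Kg h * z * Kg (- h) - q ^ nu 0 a *: z)).
rewrite mulr0 mul0r scaler0 subr0 !mulrDr !mulrDl !scalerDr !opprD addrACA (dE _ _ hx).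
rewrite addrACA (dE _ _ hy) /d subrr scale0r add0r -/(d mu).
rewrite mulr_sumr mulr_suml scaler_sumr -sumrB => E.
have : d mu *: x = 0.
  apply: (IH [seq (e.1, d e.1 *: e.2) | e <- s]); rewrite ?size_map //.
  - exact: keigenZ.
  - move=> _ /mapP [e es ->] /=.
    have [he em] : keigen e.1 e.2 /\ e.1 != mu by apply: sP; rewrite inE es orbT.
    by split=> //; apply: keigenZ.
  rewrite big_map -[RHS]E; congr (_ + _); apply: eq_big_seq => e es /=.
  by have [he _] := sP e (@mem_behead _ (_ :: _) _ es); rewrite -dE.
move/eqP; rewrite scaler_eq0 subr_eq0 => /orP[/eqP/qexp_inj E'|/eqP //].
by rewrite E' eqxx in na.
Qed.

Lemma wsum_indep mu x y :
  wsum (fun nu => nu != mu) y -> keigen mu x -> x + y = 0 -> x = 0.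
Proof.
move=> [s [sP ->]] hx; apply: keigen_indep hx _.
by move=> e /sP [[_ h] h'].
Qed.

Lemma khomog_homog mu x : khomog mu x -> x != 0 -> homog mu x.
Proof.
move=> [ux hx] x0.
have [y [z [hy hz Ex]]] : exists y z, [/\ y = 0 \/ homog mu y,
    wsum (fun nu => nu != mu) z & x = y + z].
  move: x ux {hx x0}; apply: Uminus_homog_ind.
    by exists 0, 0; split; [left|exact: wsum0|rewrite addr0].
  move=> nu x w hx _ [y [z [hy hz ->]]].
  case: (eqVneq nu mu) => [E|ne]; last first.
    exists y, (x + z); split=> //; last by rewrite addrCA.
    by apply: wsumD => //; apply: wsum_khomog ne; apply: homog_khomog.
  exists (x + y), z; split; rewrite ?addrA //; right; rewrite -E in hy *.
  by case: hy => [->|hy]; rewrite ?addr0 //; apply: homog_add.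
have ky : keigen mu y.
  by case: hy => [->|/homog_keigen //]; apply: keigen0.
have Exy : x = y.
  apply/eqP; rewrite -subr_eq0; apply/eqP; apply: (wsum_indep (wsumN hz)).
    by apply: keigenD => //; apply: keigenN.
  by rewrite Ex [y + z]addrC addrK subrr.
case: hy => [yz|]; last by rewrite Exy.
by move: x0; rewrite Exy yz eqxx.
Qed.

Section DualBar.
Variables (psi sigma : U -> U).
Hypotheses (psiP : is_psi psi) (sigmaP : is_dual_bar psi sigma).

Lemma psi0 : psi 0 = 0.
Proof.
case: psiP => _ D _ _ _; have := D 0 0 Uminus0 Uminus0.
by rewrite addr0 => /(congr1 (fun u => u - psi 0)); rewrite addrK subrr.
Qed.

Lemma psi_scale_tofrac p x : Uminus x -> psi (tofrac p *: x) = barp p *: psi x.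
Proof.
case: psiP => _ D _ Z _ ux.
have psiN y : Uminus y -> psi (- y) = - psi y.
  move=> uy; apply: (addrI (psi y)); rewrite -D ?subrr ?psi0 //.
  by rewrite -scaleN1r; apply: UminusZ.
have psin y n : Uminus y -> psi (y *+ n) = psi y *+ n.
  move=> uy; elim: n => [|n IH]; first by rewrite !mulr0n psi0.
  by rewrite !mulrS D ?IH // -scaler_nat; apply: UminusZ.
have psiz y n : Uminus y -> psi (n%:~R *: y) = n%:~R *: psi y.
  move=> uy; case: n => n; first by rewrite !scaler_nat psin.
  by rewrite NegzE !mulrNz !scaleNr !scaler_nat psiN ?psin // -scaler_nat; apply: UminusZ.
have psiq y (a : rat) : Uminus y -> psi (qvC a *: y) = qvC a *: psi y.
  move=> uy; have d0 : (denq a)%:~R != 0 :> Qv.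
    by rewrite -(rmorph_int qvC) fmorph_eq0 intr_eq0 denq_eq0.
  apply: (scalerI d0); rewrite -psiz; last exact: UminusZ.
  have E : (denq a)%:~R * qvC a = (numq a)%:~R.
    by rewrite -!(rmorph_int qvC) -rmorphM numqE mulrC.
  by rewrite !scalerA E psiz.
rewrite /barp; elim/poly_ind: p => [|p c IH].
  by rewrite tofrac0 rmorph0 horner0 !scale0r psi0.
rewrite tofracD tofracM -/v -/(qvC c) rmorphD rmorphM /= map_polyX map_polyC /=.
rewrite !hornerE !scalerDl [_ * v]mulrC -!scalerA.
rewrite D; do ?exact: UminusZ; last by do 2 apply: UminusZ.
by rewrite psiq // Z ?IH; last exact: UminusZ; rewrite scalerA mulrC -scalerA.
Qed.

Lemma psi_scale c x : Uminus x -> exists c', psi (c *: x) = c' *: psi x.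
Proof.
move=> ux; have [p [d [d0 ->]]] := Qv_fraction c; exists (barp p / barp d).
apply: (scalerI (barp_neq0 d0)); rewrite -psi_scale_tofrac; last exact: UminusZ.
by rewrite !scalerA mulrC divfK ?tofrac_eq0 // psi_scale_tofrac // mulrC divfK // barp_neq0.
Qed.

Lemma psi_homog mu x : homog mu x -> homog mu (psi x).
Proof.
case: psiP => p1 D M _ pF; elim=> [|i m z hz IH|m z z' hz IH hz' IH'|c m z hz IH].
- by rewrite p1; apply: homog_one.
- rewrite M ?pF; [|by apply: gen_mem; exists i|exact: homog_Uminus hz].
  exact: homogM (homog_Fg i).
- by rewrite D; [exact: homog_add|exact: homog_Uminus hz|exact: homog_Uminus hz'].
- by have [c' ->] := psi_scale c (homog_Uminus hz); apply: homog_scale.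
Qed.

Lemma sigmaD x y : Uminus x -> Uminus y -> sigma (x + y) = sigma x + sigma y.
Proof. by case: sigmaP => D _; apply: D. Qed.

Lemma sigma0 : sigma 0 = 0.
Proof.
have := sigmaD Uminus0 Uminus0.
by rewrite addr0 => /(congr1 (fun u => u - sigma 0)); rewrite addrK subrr.
Qed.

Lemma sigma_homog mu : root_lattice mu ->
  exists k, forall x, homog mu x -> sigma x = k *: psi x.
Proof. by move=> [c ->]; eexists => x; apply: sigmaP.2. Qed.

Lemma sigma_khomog mu x : khomog mu x -> khomog mu (sigma x).
Proof.
move=> hx; case: (eqVneq x 0) => [->|x0]; first by rewrite sigma0; apply: khomog0.
have h := khomog_homog hx x0; have [k E] := sigma_homog (homog_root_lattice h).
by rewrite E //; apply/khomogZ/homog_khomog/psi_homog.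
Qed.

Lemma sigma_scale p x : Uminus x -> sigma (tofrac p *: x) = barp p *: sigma x.
Proof.
move: x; apply: Uminus_homog_ind => [|mu x y hx uy IH].
  by rewrite scaler0 sigma0 scaler0.
have ux := homog_Uminus hx.
rewrite scalerDr !sigmaD ?IH ?scalerDr //; do ?exact: UminusZ.
have [k E] := sigma_homog (homog_root_lattice hx).
rewrite (E _ hx) (E _ (homog_scale _ hx)).
by rewrite psi_scale_tofrac // !scalerA mulrC.
Qed.

Lemma wsum_sigma p x : wsum p x -> wsum p (sigma x).
Proof.
move: x; apply: wsum_ind => [|mu x y hx pm hy IH]; first by rewrite sigma0; apply: wsum0.
rewrite sigmaD; [|exact: hx.1|exact: wsum_Uminus hy].
by apply: wsumD => //; apply: wsum_khomog pm; apply: sigma_khomog.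
Qed.

End DualBar.
End Weights.

(** * Homogeneity of the dual canonical basis *)

Section LexicographicInduction.
Variable l : nat.
Notation cvec := {ffun 'I_l -> nat}.

Definition lex_below (m : nat) (c' c : cvec) := exists k : 'I_l,
  [/\ (k < m)%N, (c' k < c k)%N & forall j : 'I_l, (j < k)%N -> c' j = c j].

Lemma lex_ind (Q : cvec -> Prop) :
  (forall c, (forall c', lex_below l c' c -> Q c') -> Q c) -> forall c, Q c.
Proof.
move=> step; suff H n : forall c, (forall c', lex_below (l - n) c' c -> Q c') -> Q c.
  by move=> c; apply: (H l) => c' [k []]; rewrite subnn ltn0.
elim: n => [|n IH] c Hc.
  by apply: step => c'; rewrite -[X in lex_below X]subn0; apply: Hc.
case: (ltnP n l) => nl; last first.
  by apply: IH => c'; rewrite (_ : l - n = l - n.+1)%N; [exact: Hc|lia].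
have ml : (l - n.+1 < l)%N by lia.
have [m Em] : exists m : 'I_l, m = (l - n.+1)%N :> nat by exists (Ordinal ml).
have [a] := ubnP (c m); elim: a c Hc => // a IHa c Hc ca.
apply: IH => c' [k [kn ck cj]].
case: (ltnP k (l - n.+1)) => km; first by apply: Hc; exists k.
have Ek : k = m by apply: val_inj => /=; rewrite Em; lia.
rewrite {}Ek in kn ck cj km *.
apply: IHa; last by move: ca ck; lia.
move=> c'' [i [im ci cij]]; apply: Hc; exists i; split=> //.
  by rewrite -cj // Em.
by move=> j ji; rewrite cij // cj // Em; lia.
Qed.

End LexicographicInduction.

Lemma seq_choice (J : eqType) (K : zmodType) (R : J -> K -> Prop) (s : seq J) :
  (forall j, exists b, R j b) -> exists f, forall j, j \in s -> R j (f j).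
Proof.
move=> h; elim: s => [|i s [f fP]].
  by exists (fun=> 0).
have [b bP] := h i; exists (fun j => if j == i then b else f j) => j.
by rewrite inE; case: eqP => [->|_] //=; apply: fP.
Qed.

Section DualCanonical.
Variables (r : nat) (rd : root_datum r) (U : quantized_enveloping rd).
Variables (l : nat) (iw : l.-tuple 'I_r) (T : 'I_r -> U -> U).
Notation cvec := {ffun 'I_l -> nat}.
Notation P := 'rV[int]_(rkP rd).
Notation beta := (beta rd iw).
Notation keigen := (@keigen r rd U).
Notation khomog := (@khomog r rd U).
Hypothesis T_braid : is_braid_inv T.

Definition pbw_weight (c : cvec) : P := - \sum_k beta k *~ (c k)%:Z.

Lemma Froot_keigen k m : keigen (- beta k *~ m%:Z) (Froot iw T k m).
Proof.
rewrite /Defs.beta -raddfN -raddfMz /= /Froot.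
elim: (take k iw) => [|i s IH] /=; last exact: keigen_braid.
by rewrite /divpow; apply/keigenZ/keigenX/keigen_Fg.
Qed.

Lemma Fup_keigen c : keigen (pbw_weight c) (Fup iw T c).
Proof.
apply: keigenZ; rewrite /Fpbw /pbw_weight -sumrN.
have -> : \sum_k - (beta k *~ (c k)%:Z) = \sum_(k <- rev (enum 'I_l)) - (beta k *~ (c k)%:Z).
  by rewrite (perm_big _ (permEl (perm_rev _))) big_enum.
elim: (rev _) => [|k s IH]; first by rewrite !big_nil; apply: keigen1.
by rewrite !big_cons; apply: keigenM => //; rewrite -mulNrz; apply: Froot_keigen.
Qed.

Variables (A : U -> Prop) (psi sigma : U -> U) (B : cvec -> U).
Hypotheses (A_unip : is_unipotent_subalgebra iw T A) (psiP : is_psi psi)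
  (sigmaP : is_dual_bar psi sigma) (B_can : is_dual_canonical iw T A sigma B).

Lemma unipotent_B c : A (B c).
Proof.
case: B_can => [[_ AB] _ _]; apply/AB; rewrite -[B c]scale1r; exact: lincomb1.
Qed.

Lemma unipotent_Fup c : A (Fup iw T c).
Proof. by case: A_unip => _ _ _ [_ AF]; apply/AF; apply: lincomb1. Qed.

Lemma unipotentD x y : A x -> A y -> A (x + y).
Proof.
by case: B_can => [[_ AB] _ _] /AB hx /AB hy; apply/AB; apply: lincombD.
Qed.

Lemma unipotentZ c x : A x -> A (c *: x).
Proof.
by case: B_can => [[_ AB] _ _] /AB hx; apply/AB; apply: lincombZ.
Qed.

Lemma unipotent_Uminus x : A x -> Uminus x.
Proof. by case: A_unip => _ _ h _; apply: h. Qed.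

Lemma Fup_khomog c : khomog (pbw_weight c) (Fup iw T c).
Proof. by split; [apply/unipotent_Uminus/unipotent_Fup|apply: Fup_keigen]. Qed.

(* By [barp_fix], the bar involution [v |-> v^-1] has no nonzero fixed point here. *)
Definition vQv (a : Qv) := exists p : {poly rat}, p`_0 = 0 /\ a = tofrac p.

Lemma vQv0 : vQv 0.
Proof. by exists 0; rewrite coef0 tofrac0. Qed.
Lemma vQvD a b : vQv a -> vQv b -> vQv (a + b).
Proof.
move=> [p [p0 ->]] [p' [p0' ->]]; exists (p + p').
by rewrite coefD p0 p0' addr0 tofracD.
Qed.
Lemma vQvN a : vQv a -> vQv (- a).
Proof. by move=> [p [p0 ->]]; exists (- p); rewrite coefN p0 oppr0 tofracN. Qed.
Lemma vQvM a b : vQv a -> vQv b -> vQv (a * b).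
Proof.
move=> [p [p0 ->]] [p' [p0' ->]]; exists (p * p').
by rewrite coef0M p0 mul0r tofracM.
Qed.
Lemma qZq_vQv a : qZq a -> vQv a.
Proof.
move=> [p ->]; exists ('X ^+ 2 * (map_poly intr p \Po 'X^2)).
by rewrite coefXnM tofracM tofracXn.
Qed.

Lemma lincomb_Fup_B x :
  (forall c, lincomb vQv (fun=> True) B (Fup iw T c - B c)) ->
  lincomb vQv (fun=> True) (Fup iw T) x -> lincomb vQv (fun=> True) B x.
Proof.
move=> H; move: x; apply: lincomb_ind => [|x y|a c ha _]; first exact: lincomb0.
  exact: (lincombD vQv0 vQvD).
rewrite -[Fup _ _ _](subrK (B c)) scalerDr; apply: (lincombD vQv0 vQvD).
  by apply: lincombZ (H c) => b; apply: vQvM.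
exact: lincomb1.
Qed.

Lemma Fup_B c : lincomb vQv (fun=> True) B (Fup iw T c - B c).
Proof.
move: c; apply: lex_ind => c IH; case: B_can => _ _ /(_ c) h.
rewrite -opprB -scaleN1r.
have : lincomb vQv (fun=> True) B (B c - Fup iw T c).
  move: h; move: (B c - _); apply: lincomb_ind => [|x y|a c' ha [[k [ck cj]] _]].
  - exact: lincomb0.
  - exact: (lincombD vQv0 vQvD).
  have hv := qZq_vQv ha.
  rewrite -[Fup _ _ c'](subrK (B c')) scalerDr; apply: (lincombD vQv0 vQvD).
    apply: lincombZ; first by move=> b; apply: vQvM.
    by apply: IH; exists k; split.
  exact: lincomb1.
by apply: lincombZ => a; rewrite mulN1r; apply: vQvN.
Qed.

Lemma sigma_fixed_vQv y : lincomb vQv (fun=> True) B y -> sigma y = y -> y = 0.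
Proof.
case: B_can => [[Bind _] sB _] /(lincomb_uniq vQv0 vQvD) [s [a [us _ Ra _ ->]]] E.
have UB c : Uminus (B c) by apply/unipotent_Uminus/unipotent_B.
have sE : sigma (\sum_(c <- s) a c *: B c)
    = \sum_(c <- s) sigma (a c *: B c).
  elim: s {us E} => [|c s IH]; first by rewrite !big_nil (sigma0 sigmaP).
  rewrite !big_cons (sigmaD sigmaP) ?IH //; first exact: UminusZ.
  by elim/big_ind: _ => [||c' _]; [exact: Uminus0|exact: gen_add|exact: UminusZ].
have [b bE] : exists b : cvec -> Qv, forall c, c \in s ->
    sigma (a c *: B c) = b c *: B c /\ (a c = b c -> a c = 0).
  apply: (seq_choice (R := fun c b =>
    sigma (a c *: B c) = b *: B c /\ (a c = b -> a c = 0))) => c.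
  have [p [p0 ->]] := Ra c; exists (barp p); split.
    by rewrite (sigma_scale psiP sigmaP) // sB.
  by move=> /(barp_fix p0) ->; rewrite tofrac0.
have : \sum_(c <- s) (a c - b c) *: B c = 0.
  under eq_bigr do rewrite scalerBl.
  rewrite sumrB -{1}E sE; apply/eqP; rewrite subr_eq0; apply/eqP.
  by apply: eq_big_seq => c cs; rewrite (bE c cs).1.
move=> /(Bind _ _ us) ab; rewrite big_seq big1 // => c cs.
by rewrite (bE c cs).2 ?scale0r //; apply/eqP; rewrite -subr_eq0 ab.
Qed.

(* The components of [B c] of weight other than that of [Fup c] form a
   [sigma]-fixed combination of the [B c'] with coefficients in [v Q[v]]. *)
Lemma dual_canonical_khomog c : khomog (pbw_weight c) (B c).
Proof.
have [_ sB /(_ c) h] := B_can.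
have {}h : lincomb vQv (fun=> True) (Fup iw T) (B c - Fup iw T c).
  by apply: lincomb_sub h => // a; apply: qZq_vQv.
have [x [y [hx hy E]]] := lincomb_split (fun c' => pbw_weight c' == pbw_weight c) h.
have kx : khomog (pbw_weight c) x.
  move: x hx {E}; apply: lincomb_ind => [|x1 x2|a c' _ /eqP <-].
  - exact: khomog0.
  - exact: khomogD.
  - exact/khomogZ/Fup_khomog.
have wy : wsum (fun nu => nu != pbw_weight c) y.
  move: y hy {E}; apply: lincomb_ind => [|y1 y2|a c' _ ne].
  - exact: wsum0.
  - exact: wsumD.
  - by apply/wsumZ/(wsum_khomog (Fup_khomog c')).
have Bz : B c = Fup iw T c + x + y.
  by rewrite -addrA -E [RHS]addrC subrK.
set z := Fup iw T c + x in Bz.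
have kz : khomog (pbw_weight c) z by apply: khomogD => //; apply: Fup_khomog.
have sz : sigma z - z = 0.
  apply: (wsum_indep (mu := pbw_weight c) (y := sigma y - y)).
  - by apply: wsumD; [apply: (wsum_sigma psiP sigmaP wy)|apply: wsumN].
  - by apply: (khomogD (sigma_khomog psiP sigmaP kz) (khomogN kz)).2.
  rewrite addrACA -(sigmaD sigmaP); [|exact: kz.1|exact: wsum_Uminus wy].
  by rewrite -opprD -Bz sB subrr.
have sy : sigma y = y.
  have := sB c; rewrite Bz (sigmaD sigmaP); [|exact: kz.1|exact: wsum_Uminus wy].
  by move/eqP: sz; rewrite subr_eq0 => /eqP -> /addrI.
have y0 : y = 0.
  apply: sigma_fixed_vQv => //; apply: lincomb_Fup_B; first exact: Fup_B.
  exact: lincomb_sub hy.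
by rewrite Bz y0 addr0.
Qed.

End DualCanonical.

Lemma expo_nonneg_ind (I : finType) (Q : {ffun I -> int} -> Prop) : Q 0 ->
  (forall m i, Q m -> Q (m + fvec i)) ->
  forall m : {ffun I -> int}, (forall i, 0 <= m i) -> Q m.
Proof.
move=> Q0 Qp m m0; rewrite [m]expoE /linext.
elim: (index_enum I) => [|i s IH]; first by rewrite big_nil.
rewrite big_cons addrC; move: (\sum_(_ <- s) _) IH => x Qx.
case: (m i) (m0 i) => // n _.
by elim: n => [|n IH]; rewrite ?mulr0z ?addr0 // intS mulrzDr mulr1z addrCA addrC; apply: Qp.
Qed.

(** * The twist automorphism *)

Section ClusterAlgebra.
Variables (I : finType) (uf : {set I}) (F : forall t : seed uf, torus_skewfield t).
Variable t : seed uf.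
Notation CA := (cluster_algebra (F := F) (t := t)).

Lemma cluster_algebraZ c x : Zv c -> CA x -> CA (c *: x).
Proof. by move=> hc hx; rewrite -[x]mul1r scalerAl; apply: gen_mul => //; apply: gen_scal. Qed.
Lemma cluster_algebra1 : CA 1.
Proof. by rewrite -[1]scale1r; apply/gen_scal/Zv1. Qed.
Lemma cluster_algebra0 : CA 0.
Proof. by rewrite -(scale0r 1); apply/gen_scal/Zv0. Qed.
Lemma cluster_algebra_clvar i : CA (clvar F t i).
Proof. by apply: gen_mem; left; exists [::], id, i. Qed.
Lemma cluster_algebra_inv j : j \notin uf -> CA (clvar F t j)^-1.
Proof. by move=> jf; apply: gen_mem; right; exists j. Qed.

End ClusterAlgebra.

Section Main.
Variables (r : nat) (rd : root_datum r) (l : nat) (iw : l.-tuple 'I_r).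
Variables (U : quantized_enveloping rd) (T : 'I_r -> U -> U) (T_braid : is_braid_inv T).
Variables (psi : U -> U) (psiP : is_psi psi).
Variables (sigma : U -> U) (sigmaP : is_dual_bar psi sigma).
Variables (A : U -> Prop) (A_unip : is_unipotent_subalgebra iw T A).
Variables (B : {ffun 'I_l -> nat} -> U) (B_can : is_dual_canonical iw T A sigma B).
Variable L : unipotent_cell iw A B.
Notation P := 'rV[int]_(rkP rd).
Notation form := (@Defs.form r rd).
Notation word := (tnth iw).
Notation ufw := (ufw iw).
Notation kmin := (kmin iw).
Notation kmax := (kmax iw).
Notation kone := (kone iw).
Notation betaI := (betaI rd iw).
Notation rho := (rho rd).
Notation khomog := (@khomog r rd U).
Notation D := (D iw B).
Notation DL := (DL L).
Notation iota := (@Defs.iota r rd U l iw A B L).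
Implicit Types (j k : 'I_l).

Lemma pbw_weight_cI j k : pbw_weight rd iw (cI iw j k) = - betaI j k.
Proof.
rewrite /pbw_weight /Defs.betaI [in RHS]big_mkcond; congr (- _); apply: eq_bigr => s _.
by rewrite ffunE; case: ifP.
Qed.

Lemma D_khomog j k : khomog (- betaI j k) (D j k).
Proof.
by rewrite -pbw_weight_cI; apply: (dual_canonical_khomog T_braid A_unip psiP sigmaP B_can).
Qed.

Lemma D_unipotent j k : A (D j k).
Proof. exact: (unipotent_B B_can). Qed.

Lemma D_neq0 j k : D j k != 0.
Proof.
apply/negP => /eqP E; case: B_can => [[Bind _] _ _].
have := Bind [:: cI iw j k] (fun=> 1); rewrite big_seq1 scale1r => /(_ isT E (cI iw j k)).
by rewrite inE eqxx => /(_ isT)/eqP; rewrite oner_eq0.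
Qed.

Lemma cell_homog_DL j k : cell_homog (- betaI j k) (DL j k).
Proof.
have A1 : A 1 by case: A_unip.
have [i1 _ _ _] := iota_morph L.
exists (D j k), 1, (- betaI j k), 0; split.
- by split; [exact: D_unipotent|apply: khomog_homog (D_khomog j k) (D_neq0 j k)].
- by split; [exact: den_one|exact: homog_one].
- by rewrite subr0.
- by rewrite i1 divr1.
Qed.

Lemma half_int_cor mu : root_lattice mu -> exists n,
  - form mu mu / 4%:R + form mu rho / 2%:R = n%:~R / 2%:R.
Proof.
move=> h; have [a ->] := root_lattice_even h; have [b ->] := root_lattice_int rho h.
by exists (b - a); rewrite !(rmorphM, rmorphB) /=; field.
Qed.

Variables (eta : L -> L) (etaP : is_kimura_oya eta).
Variables (tw : L -> L) (twP : is_tw eta tw).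

Lemma twZ c x : tw (c *: x) = c *: tw x.
Proof.
case: twP => twl _; have := twl c x 0; rewrite !addr0 => ->.
have := twl 1 0 0; rewrite !scale1r addr0 => /(congr1 (fun u => u - tw 0)).
by rewrite addrK subrr => <-; rewrite addr0.
Qed.

Lemma tw_corD j k (n : int) :
  - form (betaI j k) (betaI j k) / 4%:R + form (betaI j k) rho / 2%:R = n%:~R / 2%:R ->
  tw (corD L j k) = v ^ n *: eta (DL j k).
Proof.
case: etaP => eta_iso _ _ En; set b := betaI j k in En *.
have hb : root_lattice b by apply: root_lattice_betaI.
have [a Ea] := root_lattice_int rho hb.
have [_ twE] := twP.
rewrite /corD /cor twZ (twE _ _ (cell_homog_DL j k)) -/b (alg_isoZ eta_iso) scalerA.
congr (_ *: _); rewrite (@qpowE (- form (- b) rho) (2 * a)); last first.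
  by rewrite formNl Ea rmorphM /= opprK; field.
rewrite (qpowE (n := n - 2 * a)) -?expfzDr ?v_neq0 //; first by congr (v ^ _); lia.
rewrite rmorphB rmorphM /= mulrBl -En !formNl formNr opprK Ea.
by field.
Qed.

Lemma corDE j k (n : int) :
  - form (betaI j k) (betaI j k) / 4%:R - form (betaI j k) rho / 2%:R = n%:~R / 2%:R ->
  corD L j k = v ^ n *: DL j k.
Proof.
by move=> En; rewrite /corD /cor (qpowE (n := n)) // !formNl formNr opprK -En !mulNr.
Qed.

Variable F : forall t : seed ufw, torus_skewfield t.
Notation F0 := (F (t0 rd iw)).
Notation CA := (cluster_algebra (F := F) (t := t0 rd iw)).
Notation X0 := (Defs.X F0).
Variables (kappa : F0 -> L) (kappaP : is_cluster_iso T kappa).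
Hypothesis t0_skew : skew_seed (t0 rd iw).
Implicit Types (x y : F0).

Lemma kappa1 : kappa 1 = 1.
Proof. by case: kappaP => [[[-> _ _ _] _ _ _] _]. Qed.
Lemma kappaD x y : CA x -> CA y -> kappa (x + y) = kappa x + kappa y.
Proof. by case: kappaP => [[[_ h _ _] _ _ _] _]; apply: h. Qed.
Lemma kappaM x y : CA x -> CA y -> kappa (x * y) = kappa x * kappa y.
Proof. by case: kappaP => [[[_ _ h _] _ _ _] _]; apply: h. Qed.
Lemma kappaZ c x : Zv c -> CA x -> kappa (c *: x) = c *: kappa x.
Proof. by case: kappaP => [[[_ _ _ h] _ _ _] _]; apply: h. Qed.
Lemma kappa_inj x y : CA x -> CA y -> kappa x = kappa y -> x = y.
Proof. by case: kappaP => [[_ _ h _] _]; apply: h. Qed.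
Lemma kappa0 : kappa 0 = 0.
Proof. by rewrite -(scale0r 1) kappaZ ?scale0r //; [exact: Zv0|exact: cluster_algebra1]. Qed.
Lemma kappa_clvar j : kappa (clvar F _ j) = corD L (kmin j) j.
Proof. by case: kappaP. Qed.

Lemma clvar_unit j : clvar F (t0 rd iw) j \is a GRing.unit.
Proof. exact: X_unit. Qed.

Lemma kappa_clvarV j : j \notin ufw ->
  kappa (clvar F _ j)^-1 = (corD L (kmin j) j)^-1.
Proof.
move=> jf; have hj := cluster_algebra_inv F (t0 rd iw) jf.
have hj' := cluster_algebra_clvar F (t0 rd iw) j.
have e1 : kappa (clvar F _ j) * kappa (clvar F _ j)^-1 = 1.
  by rewrite -kappaM // divrr ?kappa1 // clvar_unit.
have e2 : kappa (clvar F _ j)^-1 * kappa (clvar F _ j) = 1.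
  by rewrite -kappaM // mulVr ?kappa1 // clvar_unit.
have u : kappa (clvar F _ j) \is a GRing.unit by apply/unitrP; exists (kappa (clvar F _ j)^-1).
by rewrite -kappa_clvar; apply: (mulrI u); rewrite e1 divrr.
Qed.

Definition weight0 j : P := - betaI (kmin j) j.
Notation wt0 := (linext weight0).

Lemma weight0_graded : graded (t0 rd iw) weight0.
Proof.
move=> k; transitivity (- \sum_j betaI (kmin j) j *~ bmat (t0 rd iw) j k).
  rewrite -sumrN; apply: eq_bigr => j _; by rewrite BcolE mulNrz.
by rewrite t0_balanced oppr0.
Qed.

Definition kappa_homog nu x := CA x /\
  exists a, [/\ A a, khomog nu a & kappa x = iota a].

Lemma kappa_homogD nu x y : kappa_homog nu x -> kappa_homog nu y -> kappa_homog nu (x + y).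
Proof.
have [_ iD _ _] := iota_morph L.
move=> [cx [a [Aa ha Ea]]] [cy [b [Ab hb Eb]]]; split; first exact: gen_add.
exists (a + b); split; [exact: (unipotentD B_can)|exact: khomogD|].
by rewrite kappaD // Ea Eb iD.
Qed.

Lemma kappa_homogM nu nu' x y :
  kappa_homog nu x -> kappa_homog nu' y -> kappa_homog (nu + nu') (x * y).
Proof.
have [_ _ iM _] := iota_morph L; have [_ AM _ _] := A_unip.
move=> [cx [a [Aa ha Ea]]] [cy [b [Ab hb Eb]]]; split; first exact: gen_mul.
exists (a * b); split; [exact: AM|exact: khomogM|].
by rewrite kappaM // Ea Eb iM.
Qed.

Lemma kappa_homogZ nu c x : Zv c -> kappa_homog nu x -> kappa_homog nu (c *: x).
Proof.
have [_ _ _ iZ] := iota_morph L.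
move=> hc [cx [a [Aa ha Ea]]]; split; first exact: cluster_algebraZ.
exists (c *: a); split; [exact: (unipotentZ B_can)|exact: khomogZ|].
by rewrite kappaZ // Ea iZ.
Qed.

Lemma kappa_homog0 nu : kappa_homog nu 0.
Proof.
have [_ _ _ iZ] := iota_morph L; have [A1 _ _ _] := A_unip.
split; first exact: cluster_algebra0.
exists (0 *: 1); split; rewrite ?iZ ?scale0r ?kappa0 //; last exact: khomog0.
by rewrite -(scale0r 1); apply: (unipotentZ B_can).
Qed.

Lemma kappa_homog_corD j k x : CA x -> kappa x = corD L j k ->
  kappa_homog (- betaI j k) x.
Proof.
have [_ _ _ iZ] := iota_morph L.
move=> cx Ex; split=> //; rewrite Ex /corD /cor; set c := qpow _.
exists (c *: D j k); split.
- exact/(unipotentZ B_can)/D_unipotent.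
- exact/khomogZ/D_khomog.
- by rewrite iZ //; apply: D_unipotent.
Qed.

Lemma kappa_homogX (m : {ffun 'I_l -> int}) :
  (forall i, 0 <= m i) -> kappa_homog (wt0 m) (X0 m).
Proof.
move: m; apply: expo_nonneg_ind => [|m i IH].
  have [A1 _ _ _] := A_unip; have [i1 _ _ _] := iota_morph L.
  rewrite raddf0 X_zero; split; first exact: cluster_algebra1.
  by exists 1; split; [|exact: khomog1|rewrite kappa1 i1].
rewrite XD raddfD /= linext_fvec; apply: kappa_homogZ; first exact: Zv_v.
apply: kappa_homogM => //; apply: kappa_homog_corD; first exact: cluster_algebra_clvar.
exact: kappa_clvar.
Qed.

(* Multiplying by a large monomial clears the denominators of a Laurent polynomial. *)
Lemma kappa_homog_torus nu x : torus_homog weight0 nu x ->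
  exists2 M : {ffun 'I_l -> int}, (forall i, 0 <= M i) &
    forall M' : {ffun 'I_l -> int}, (forall i, 0 <= M' i) ->
    kappa_homog (nu + wt0 (M + M')) (x * X0 (M + M')).
Proof.
move: x; apply: lincomb_ind => [|x y [M M0 hM] [M' M0' hM']|c m Rc /eqP <-].
- by exists 0 => [i|M' _]; rewrite ?ffunE // mul0r; apply: kappa_homog0.
- exists (M + M') => [i|M'' M0'']; first by rewrite ffunE addr_ge0.
  rewrite mulrDl; apply: kappa_homogD.
    by rewrite -addrA; apply: hM => i; rewrite ffunE addr_ge0.
  by rewrite [M + M']addrC -addrA; apply: hM' => i; rewrite ffunE addr_ge0.
exists [ffun i => `|m i|] => [i|M' M0']; first by rewrite ffunE.
rewrite -scalerAl X_mul -raddfD; do 2 (apply: kappa_homogZ => //); first exact: Zv_v.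
apply: kappa_homogX => i; rewrite !ffunE addrA addr_ge0 // -lerBlDl sub0r.
by rewrite (le_trans (ler_norm _)) // normrN.
Qed.

Lemma khomog_weight_unique nu nu' (a : U) : a != 0 -> khomog nu a -> khomog nu' a -> nu = nu'.
Proof.
move=> a0 [_ h] [_ h']; apply/rowP => i; apply: qexp_inj.
have := h (delta_mx 0 i); rewrite h' !pairing_delta => /eqP.
by rewrite eq_sym -subr_eq0 -scalerBl scaler_eq0 (negbTE a0) orbF subr_eq0 => /eqP.
Qed.

Lemma weight_of_homog_fraction nu nu' x : x != 0 ->
  kappa_homog nu' x -> homog_fraction weight0 nu x -> nu = nu'.
Proof.
move=> x0 hx [al [be [a [b [ha hb b0 -> E]]]]].
have [Ma Ma0 hMa] := kappa_homog_torus ha.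
have [Mb Mb0 hMb] := kappa_homog_torus hb.
have [ca [a' [Aa' ha' Ea']]] := hMa _ Mb0.
have := hMb _ Ma0; rewrite [Mb + Ma]addrC => hb'.
have [_ [d [Ad hd Ed]]] := kappa_homogM hx hb'.
have Exy : a * X0 (Ma + Mb) = x * (b * X0 (Ma + Mb)).
  by rewrite E !mulrA divrK //; apply: skf_division.
have Ead : a' = d.
  by apply: (iota_inj (u := L)) => //; rewrite -Ea' -Ed Exy.
have a'0 : a' != 0.
  apply/negP => /eqP a'0; have [_ _ _ iZ] := iota_morph L; have [A1 _ _ _] := A_unip.
  have : a * X0 (Ma + Mb) = 0.
    apply: kappa_inj => //; first exact: cluster_algebra0.
    by rewrite kappa0 Ea' a'0 -(scale0r 1) iZ // scale0r.
  move=> /skf_mulf_eq0 /(_ (X_neq0 _ _)) a0.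
  by move: x0; rewrite E a0 mul0r eqxx.
rewrite -Ead in hd; have /eqP := khomog_weight_unique a'0 ha' hd.
by rewrite addrA (inj_eq (addIr _)) -subr_eq => /eqP.
Qed.

Notation unfrozen := (unfrozen ufw).
Variables (ks : seq unfrozen) (sg : {perm unfrozen}).
Notation t1 := (mutseq (t0 rd iw) ks).
Notation X1 := (Defs.X (F t1)).
Variables (mu : F t1 -> F0) (mu_mut : is_mutseq_iso mu).
Hypothesis sg_bmat : forall i j : unfrozen,
  bmat t1 (val (sg i)) (sg j) = bmat (t0 rd iw) (val i) j.
Hypothesis mu_corD : forall k : unfrozen,
  kappa (mu (clvar F t1 (val (sg k)))) = corD L (kone (val k)) (kmax (val k)).
Variables (twF : F0 -> F0) (twFP : is_transported kappa tw twF).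
Variables (d : unfrozen -> int) (d_pos : dpos d) (t0_compat : compat (t0 rd iw) d).
Hypothesis sg_d : forall k : unfrozen, d (sg k) = d k.

Lemma half_int_betaI j k : exists n n' : int,
  - form (betaI j k) (betaI j k) / 4%:R + form (betaI j k) rho / 2%:R = n%:~R / 2%:R /\
  - form (betaI j k) (betaI j k) / 4%:R - form (betaI j k) rho / 2%:R = n'%:~R / 2%:R.
Proof.
have h := root_lattice_betaI iw rd j k.
have [n En] := half_int_cor h; have [n' En'] := half_int_cor (root_latticeN h).
exists n, n'; split=> //; move: En'; rewrite !formNl formNr opprK => <-.
by rewrite !mulNr.
Qed.

Lemma varpi_betaI_int i j k : exists m : int, form (varpi rd i) (betaI j k) = m%:~R.
Proof. by rewrite Defs.formC; apply/root_lattice_int/root_lattice_betaI. Qed.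

Lemma DL_unit k : DL (kmin k) (kmax k) \is a GRing.unit.
Proof. exact: iota_unit. Qed.

Lemma vexp_unit (n : int) : v ^ n \is a GRing.unit.
Proof. by rewrite unitfE expfz_neq0 // v_neq0. Qed.

Lemma twF_frozen j : j \notin ufw -> twF (clvar F _ j) = (clvar F _ j)^-1.
Proof.
move=> jf; case: twFP => twF_iso tr; have [CAj kj] := tr _ (cluster_algebra_clvar F _ j).
apply: kappa_inj => //; first exact: cluster_algebra_inv.
rewrite kj kappa_clvarV // kappa_clvar.
have [n [n' [En En']]] := half_int_betaI (kmin j) j.
have [m Em] := varpi_betaI_int (word j) (kmin j) j.
rewrite (tw_corD En) (corDE En'); case: etaP => eta_iso _ /(_ j).
have uj := DL_unit j; rewrite (kmaxK jf) in uj * => etaV.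
have -> : eta (DL (kmin j) j) = v ^ (2 * m) *: (DL (kmin j) j)^-1.
  apply: invr_inj; rewrite -(alg_isoV eta_iso) // etaV invrZ ?unitrV ?vexp_unit // invrK.
  congr (_ *: _); rewrite formNr Em (qpowE (n := - (2 * m))) ?invr_expz //.
  by rewrite rmorphN rmorphM /=; field.
rewrite scale_vM invrZ ?vexp_unit // invr_expz; congr (v ^ _ *: _).
apply: (@intr_inj rat); rewrite rmorphD rmorphM rmorphN /=.
have r1 (x y : rat) : x = y / 2%:R -> y = 2%:R * x by move=> ->; field.
by rewrite (r1 _ _ En) (r1 _ _ En') form_betaI_self Em; field.
Qed.

Lemma cluster_algebra_mu j : CA (mu (clvar F t1 j)).
Proof. by apply: gen_mem; left; exists ks, mu, j. Qed.

Lemma twF_unfrozen (k : unfrozen) : twF (clvar F _ (val k))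
  = v ^ (- Lam (t0 rd iw) (kmax (val k)) (val k)) *:
    ((clvar F _ (kmax (val k)))^-1 * mu (clvar F t1 (val (sg k)))).
Proof.
have ku := valP k; set kk := val k in ku *; have kf := kmax_frozen iw kk.
case: twFP => twF_iso tr; have [CAk kk'] := tr _ (cluster_algebra_clvar F _ kk).
have CAV := cluster_algebra_inv F (t0 rd iw) kf.
have CAm := cluster_algebra_mu (val (sg k)).
have CAVm : CA ((clvar F _ (kmax kk))^-1 * mu (clvar F t1 (val (sg k)))) by apply: gen_mul.
apply: kappa_inj => //; first by apply: cluster_algebraZ => //; apply: Zv_v.
rewrite kk' kappaZ ?kappaM ?kappa_clvarV ?kappa_clvar ?mu_corD -/kk //; last exact: Zv_v.
have [n1 [_ [En1 _]]] := half_int_betaI (kmin kk) kk.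
have [_ [n2 [_ En2]]] := half_int_betaI (kmin (kmax kk)) (kmax kk).
have [_ [n3 [_ En3]]] := half_int_betaI (kone kk) (kmax kk).
have [m Em] := varpi_betaI_int (word kk) (kmin kk) kk.
rewrite (tw_corD En1) (corDE En2) (corDE En3) invrZ ?vexp_unit //; last first.
  by rewrite kmin_kmax; apply: DL_unit.
case: etaP => _ /(_ _ ku) -> _; rewrite kmin_kmax formNr opprK.
rewrite (qpowE (n := 2 * m)); last by rewrite Em rmorphM /=; field.
rewrite -scalerAl -scalerAr invr_expz !scale_vM; congr (v ^ _ *: _).
apply: (@intr_inj rat); rewrite !(rmorphD, rmorphM, rmorphN) /= Lam_t0_kmax // -Em.
move: En2; rewrite betaI_split // => En2.
have r1 (x y : rat) : x = y / 2%:R -> y = 2%:R * x by move=> ->; field.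
rewrite (r1 _ _ En1) (r1 _ _ En2) (r1 _ _ En3) !(Defs.formDl, formDr).
rewrite (Defs.formC (betaI (kmin kk) kk) (betaI (kone kk) _)).
rewrite form_betaI_self.
by field.
Qed.

(* The exponent of [var (X_j)]: the frozen factors of the variation map are
   [p_k = X_(k^max)^-1]. *)
Definition theta j : {ffun 'I_l -> int} :=
  if insub j is Some k then - fvec (kmax j) + fvec (val (sg k)) else - fvec j.

Lemma theta_unfrozen (k : unfrozen) :
  theta (val k) = - fvec (kmax (val k)) + fvec (val (sg k)).
Proof. by rewrite /theta valK. Qed.

Lemma theta_frozen j : j \notin ufw -> theta j = - fvec j.
Proof. by move=> jf; rewrite /theta insubN. Qed.

Lemma case_unfrozen (Q : 'I_l -> Prop) : (forall k : unfrozen, Q (val k)) ->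
  (forall j, j \notin ufw -> Q j) -> forall j, Q j.
Proof.
move=> Hu Hf j; case: (boolP (j \in ufw)) => ju; last exact: Hf.
exact: (Hu (Sub j ju)).
Qed.

Definition mutseq_facts := mutseq_homog d_pos t0_compat weight0_graded mu_mut.

Lemma t1_compat : compat t1 d. Proof. by case: mutseq_facts. Qed.
Lemma t1_skew : skew_seed t1. Proof. exact: t1_compat.1. Qed.
Lemma mu_iso : alg_iso mu. Proof. by case: mutseq_facts. Qed.
Lemma mu_frozen j : j \notin ufw -> mu (clvar F _ j) = clvar F _ j.
Proof. by case: mutseq_facts => _ _ h _; apply: h. Qed.

Lemma mu_theta_unfrozen (k : unfrozen) : mu (X1 (theta (val k)))
  = v ^ lam t1 (fvec (kmax (val k))) (fvec (val (sg k))) *: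
    ((clvar F _ (kmax (val k)))^-1 * mu (clvar F t1 (val (sg k)))).
Proof.
rewrite theta_unfrozen XD lamNl opprK (alg_isoZ mu_iso) (alg_isoM mu_iso).
rewrite -X_inv; last exact: t1_skew.
rewrite (alg_isoV mu_iso) ?X_unit // -[X1 (fvec (kmax _))]/(clvar F t1 _).
by rewrite mu_frozen // kmax_frozen.
Qed.

Lemma twF_theta_scalar j : exists n : int, twF (clvar F _ j) = v ^ n *: mu (X1 (theta j)).
Proof.
move: j; apply: case_unfrozen => [k|j jf].
  rewrite twF_unfrozen mu_theta_unfrozen.
  exists (- Lam (t0 rd iw) (kmax (val k)) (val k)
    - lam t1 (fvec (kmax (val k))) (fvec (val (sg k)))).
  by rewrite scale_vM subrK.
exists 0; rewrite expr0z scale1r twF_frozen // theta_frozen // -X_inv; last exact: t1_skew.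
by rewrite (alg_isoV mu_iso) ?X_unit // -[X1 (fvec j)]/(clvar F t1 _) mu_frozen.
Qed.

(* Both sides are read off the commutation of two monomials, which [twF] and [mu]
   preserve; scalars do not matter. *)
Lemma lam_theta i j : lam t1 (theta i) (theta j) = Lam (t0 rd iw) i j.
Proof.
have [twF_iso _] := twFP.
have [n Ei] := twF_theta_scalar i; have [n' Ej] := twF_theta_scalar j.
have : twF (clvar F _ i * clvar F _ j)
    = v ^ (2 * Lam (t0 rd iw) i j) *: twF (clvar F _ j * clvar F _ i).
  by rewrite -(alg_isoZ twF_iso) /clvar X_comm // lam_fvec.
rewrite !(alg_isoM twF_iso) Ei Ej -!scalerAl -!scalerAr !scale_vM -!(alg_isoM mu_iso).
rewrite [X1 (theta i) * _]X_comm; last exact: t1_skew.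
rewrite (alg_isoZ mu_iso) !scale_vM => /scale_v_inj.
rewrite alg_iso_neq0 ?skf_mulf_neq0 ?X_neq0 //; last exact: mu_iso.
by move=> /(_ isT); lia.
Qed.

Lemma twF_clvar j : twF (clvar F _ j) = mu (X1 (theta j)).
Proof.
move: j; apply: case_unfrozen => [k|j jf]; last first.
  rewrite twF_frozen // theta_frozen // -X_inv; last exact: t1_skew.
  by rewrite (alg_isoV mu_iso) ?X_unit // -[X1 (fvec j)]/(clvar F t1 _) mu_frozen.
rewrite twF_unfrozen mu_theta_unfrozen; congr (v ^ _ *: _).
rewrite -(lam_theta (kmax (val k)) (val k)) theta_unfrozen theta_frozen ?kmax_frozen //.
by rewrite lamNl lamDr lamNr lamm ?oppr0 ?add0r ?opprK //; apply: t1_skew.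
Qed.

Lemma lam_linext_theta m m' : lam t1 (linext theta m) (linext theta m') = lam (t0 rd iw) m m'.
Proof.
rewrite lam_linextl [RHS]lamE; apply: eq_linext => i.
by rewrite lam_linextr; apply: eq_linext => j; rewrite lam_theta.
Qed.

Lemma twF_X m : twF (X0 m) = mu (X1 (linext theta m)).
Proof.
have [twF_iso _] := twFP; have tE i := twF_clvar i.
move: m; apply: expo_ind => [|m i IH|m i IH].
- by rewrite !raddf0 !X_zero (alg_iso1 twF_iso) (alg_iso1 mu_iso).
- rewrite raddfD /= linext_fvec !XD (alg_isoZ twF_iso) (alg_isoZ mu_iso).
  rewrite (alg_isoM twF_iso) (alg_isoM mu_iso) IH -tE; congr (v ^ _ *: _).
  by rewrite -lam_linext_theta linext_fvec.
- rewrite raddfB /= linext_fvec !XD (alg_isoZ twF_iso) (alg_isoZ mu_iso).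
  rewrite (alg_isoM twF_iso) (alg_isoM mu_iso) IH -!X_inv ?t1_skew //; last exact: t1_skew.
  rewrite (alg_isoV twF_iso) ?X_unit // (alg_isoV mu_iso) ?X_unit // -tE; congr (v ^ _ *: _).
  by rewrite -[in LHS]lam_linext_theta raddfN /= linext_fvec.
Qed.

(* The two exponents have the same unfrozen part, and the monomial of their
   difference is central and of weight zero. *)
Lemma theta_balanced (k : unfrozen) :
  linext theta (Bcol (t0 rd iw) k) = Bcol t1 (sg k).
Proof.
have [_ _ _ [om1 [om1f g1 h1]]] := mutseq_facts.
have [_ dB1] := t1_compat; have [_ dB0] := t0_compat.
have om1k (k' : unfrozen) : om1 (val (sg k')) = - betaI (kone (val k')) (kmax (val k')).
  apply: (weight_of_homog_fraction (x := mu (clvar F t1 (val (sg k'))))).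
  - by apply: alg_iso_neq0; [exact: mu_iso|exact: X_neq0].
  - apply: kappa_homog_corD; [exact: cluster_algebra_mu|exact: mu_corD].
  - apply: h1; apply: homog_fraction_torus.
    by rewrite -[om1 _](linext_fvec om1); apply: torus_homogX.
have om1_theta j : linext om1 (theta j) = - weight0 j.
  move: j; apply: case_unfrozen => [k'|j jf].
    rewrite theta_unfrozen raddfD raddfN /= !linext_fvec om1k om1f ?kmax_frozen //.
    by rewrite /weight0 betaI_split ?(valP k') // !opprK addrK.
  by rewrite theta_frozen // raddfN /= linext_fvec om1f.
pose p := linext theta (Bcol (t0 rd iw) k) - Bcol t1 (sg k).
have pf j : j \in ufw -> p j = 0.
  move=> ju; pose k1 : unfrozen := Sub j ju.
  pose k2 := (sg^-1)%g k1.
  have Ej : j = val (sg k2) by rewrite permKV SubK.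
  rewrite /p !ffunE BcolE Ej sg_bmat /linext sum_ffunE.
  rewrite (bigD1 (val k2)) //= big1 => [|i].
    rewrite addr0 ffunMzE theta_unfrozen BcolE !ffunE eqxx.
    have /negbTE -> : val (sg k2) != kmax (val k2).
      by rewrite eq_sym frozen_neq // kmax_frozen.
    by rewrite oppr0 add0r mul1r subrr.
  move: i; apply: case_unfrozen => [k3|i iuf] ne; rewrite ffunMzE.
    rewrite theta_unfrozen !ffunE.
    have /negbTE -> : val (sg k2) != kmax (val k3).
      by rewrite eq_sym frozen_neq // kmax_frozen.
    rewrite (inj_eq val_inj) (inj_eq perm_inj) -(inj_eq val_inj) eq_sym (negbTE ne).
    by rewrite oppr0 add0r mul0r.
  by rewrite theta_frozen // !ffunE eq_sym (negbTE (frozen_neq _ iuf)) oppr0 mul0r.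
have theta_p : linext theta (- p) = p.
  rewrite [RHS]expoE /linext; apply: eq_bigr => j _; rewrite ffunE mulrNz.
  case: (boolP (j \in ufw)) => [/pf ->|jf]; first by rewrite !mulr0z oppr0.
  by rewrite theta_frozen // mulNrz opprK.
have lam_p j : lam (t0 rd iw) p (fvec j) = 0.
  apply: oppr_inj; rewrite oppr0 -lamNl -lam_linext_theta theta_p linext_fvec.
  rewrite /p lamDl lamNl -{1}[theta j](linext_fvec theta) lam_linext_theta dB0.
  move: j; apply: case_unfrozen => [k'|j jf].
    rewrite theta_unfrozen lamDr lamNr !dB1 !(inj_eq val_inj) (inj_eq perm_inj).
    rewrite (negbTE (frozen_neq _ (kmax_frozen _ _))) oppr0 add0r.
    by case: eqP => [_|_]; rewrite ?sg_d ?subrr.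
  by rewrite theta_frozen // lamNr dB1 !(negbTE (frozen_neq _ jf)) !oppr0 addr0.
have wt_p : \sum_j betaI (kmin j) j *~ p j = 0.
  have E1 : linext om1 p = 0.
    rewrite /p raddfB /= g1 subr0.
    have -> m : linext om1 (linext theta m) = - linext weight0 m.
      move: m; apply: expo_ind => [|m i E|m i E].
      - by rewrite !raddf0.
      - by rewrite !raddfD /= E !linext_fvec om1_theta.
      - by rewrite !raddfB /= E !linext_fvec om1_theta.
    by rewrite weight0_graded oppr0.
  transitivity (- linext om1 p); last by rewrite E1 oppr0.
  rewrite /linext -sumrN; apply: eq_bigr => j _.
  case: (boolP (j \in ufw)) => [/pf ->|jf]; first by rewrite !mulr0z oppr0.
  by rewrite om1f // /weight0 mulNrz opprK.
have := frozen_kernel pf lam_p wt_p; rewrite /p => /eqP.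
by rewrite subr_eq0 => /eqP.
Qed.

Lemma twF_variation : exists2 var : F0 -> F t1, is_variation sg var & twF =1 mu \o var.
Proof.
have [twF_iso _] := twFP.
have [g giso gK] := alg_iso_inverse mu_iso.
have muK (y : F t1) : g (mu y) = y by apply: (alg_iso_inj mu_iso); rewrite gK.
have varX m : (g \o twF) (X0 m) = X1 (linext theta m) by rewrite /= twF_X muK.
have theta_u u : @frozen_expo _ ufw u -> linext theta u = - u.
  move=> uf0; rewrite [in RHS](expoE u) /linext -sumrN; apply: eq_bigr => j _.
  case: (boolP (j \in ufw)) => [/uf0 ->|jf]; first by rewrite !mulr0z oppr0.
  by rewrite theta_frozen // mulNrz.
have frozenN u : @frozen_expo _ ufw u -> @frozen_expo _ ufw (- u).
  by move=> uf0 i iu; rewrite ffunE uf0 // oppr0.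
exists (g \o twF) => [|x]; last by rewrite /= gK.
split.
- exact: alg_iso_comp twF_iso giso _.
- move=> k; exists (- fvec (kmax (val k))).
    move=> i iu; rewrite !ffunE; case: eqP => [E|_]; last by rewrite oppr0.
    by have := kmax_frozen iw (val k); rewrite -E iu.
  by rewrite varX linext_fvec theta_unfrozen.
- by move=> k; rewrite varX theta_balanced.
- by move=> _ [u uf0 ->]; rewrite varX theta_u //; exists (- u) => //; apply: frozenN.
- move=> _ [u uf0 ->]; exists (X0 (- u)); first by exists (- u) => //; apply: frozenN.
  by rewrite varX theta_u ?opprK //; apply: frozenN.
Qed.

End Main.

Theorem theorem9p4p5 (r : nat) (rd : root_datum r)
  (* a Weyl group element with a reduced word *)
  (w : 'rV[int]_(rkP rd) -> 'rV[int]_(rkP rd)) (l : nat) (iw : l.-tuple 'I_r)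
  (w_red : reduced_word w iw)
  (* quantum groups, the dual canonical basis and the quantum unipotent cell *)
  (U : quantized_enveloping rd)
  (T : 'I_r -> U -> U) (T_braid : is_braid_inv T)
  (psi : U -> U) (psiP : is_psi psi)
  (sigma : U -> U) (sigmaP : is_dual_bar psi sigma)
  (A : U -> Prop) (A_unip : is_unipotent_subalgebra iw T A)
  (B : {ffun 'I_l -> nat} -> U) (B_can : is_dual_canonical iw T A sigma B)
  (L : unipotent_cell iw A B)
  (* the skew-fields F(t) and the isomorphism between A_q(t0) and the cell *)
  (F : forall t : seed (ufw iw), torus_skewfield t)
  (t0_seed : is_quantum_seed (t0 rd iw))
  (kappa : F (t0 rd iw) -> L) (kappaP : is_cluster_iso T kappa)
  (* the seed t0[1] *)
  (ks : seq (unfrozen (ufw iw))) (sg : {perm (unfrozen (ufw iw))})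
  (mu : F (mutseq (t0 rd iw) ks) -> F (t0 rd iw))
  (mu_shift : is_shift sg mu)
  (sg_bmat : forall i j : unfrozen (ufw iw),
      bmat (mutseq (t0 rd iw) ks) (val (sg i)) (sg j)
      = bmat (t0 rd iw) (val i) j)
  (sg_dprime : forall k, dprime (t0 rd iw) (sg k) = dprime (t0 rd iw) k)
  (mu_corD : forall k : unfrozen (ufw iw),
      kappa (mu (clvar F (mutseq (t0 rd iw) ks) (val (sg k))))
      = corD L (kone iw (val k)) (kmax iw (val k)))
  (* the twist automorphism tw_w, on the cell and on F(t0) *)
  (eta : L -> L) (etaP : is_kimura_oya eta)
  (tw : L -> L) (twP : is_tw eta tw)
  (twF : F (t0 rd iw) -> F (t0 rd iw)) (twFP : is_transported kappa tw twF) :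
  (exists2 var : F (t0 rd iw) -> F (mutseq (t0 rd iw) ks),
     is_variation sg var & twF =1 mu \o var)
  /\ is_DT_twist twF.
Proof.
have [_ _ sk [d' [d'_gt0 d'E]]] := t0_seed.
pose d k : int := (d' k)%:Z.
have c0 : compat (t0 rd iw) d.
  by split=> // k j; rewrite lam_Bcol_fvec d'E.
have sg_d k : d (sg k) = d k.
  by have := sg_dprime k; rewrite /dprime !d'E !eqxx.
have d_pos : dpos d by move=> k; rewrite /d ltz_nat.
have H : exists2 var : F (t0 rd iw) -> F (mutseq (t0 rd iw) ks),
    is_variation sg var & twF =1 mu \o var.
  exact: (twF_variation T_braid psiP sigmaP A_unip B_can etaP twP kappaP sk
    mu_shift.1 sg_bmat mu_corD twFP d_pos c0 sg_d).
split=> //; have [var hvar E] := H.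
by exists ks, sg, mu, var.
Qed.
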